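(* Let $p\in\mathbb R^I$ be a probability vector with positive entries and suppose $\vartheta_p>0$; let $\widetilde N^n_{ij}$ be integers as provided by Lemma 5, i.e. satisfying (for all large $n$) $\lambda^n_i=\sum_{j\in\mathcal J(i)}\mu^n_{ij}\widetilde N^n_{ij}-\vartheta_pp_i\sqrt n+\epsilon^n_i$ with $\epsilon^n_i/\sqrt n\to0$, $|N^n_{ij}-\widetilde N^n_{ij}|\le C\sqrt n$ for a constant $C$, and $\sum_{i\in\mathcal I(j)}\widetilde N^n_{ij}=N^n_j$. Then there exist $\epsilon>0$, $n_0\in\mathbb N$ and constants $C_0,C_1>0$ such that $$\mathcal L^n_z\widetilde V_\epsilon(x)\le C_0-C_1\widetilde V_\epsilon(x)\qquad\text{for all }z\in\mathscr Z^n,\ x\in\mathbb Z^I_+,\ n\ge n_0.$$ In particular, for every $n\ge n_0$ and $z\in\mathscr Z^n$, the process $\widetilde X^n=\tilde x^n(X^n)$ is exponentially ergodic with a unique invariant probability measure $\widetilde\pi^n$, and there is $\kappa>0$ with $\lim_{t\to\infty}e^{\kappa t}\|P^n_t(x,\cdot)-\widetilde\pi^n\|_{\mathrm{TV}}=0$ for all $x$, where $P^n_t$ is the transition probability of $\widetilde X^n$.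
   Context: Network and parameters: $\mathcal I=\{1,\dots,I\}$, $\mathcal J=\{1,\dots,J\}$, edges $\mathcal E\subset\mathcal I\times\mathcal J$ with the bipartite graph $\mathcal G=(\mathcal I\cup\mathcal J,\mathcal E)$ a tree; $i\sim j$ iff $(i,j)\in\mathcal E$, $\mathcal J(i)=\{j:i\sim j\}$, $\mathcal I(j)=\{i:i\sim j\}$; $\mathbb R^{\mathcal G}$ (resp. $\mathbb Z^{\mathcal G}_+$) denotes arrays in $\mathbb R^{I\times J}$ (resp. with nonnegative integer entries) vanishing off $\mathcal E$. For each $n\in\mathbb N$: $\lambda^n_i>0$, $\mu^n_{ij}>0$, $N^n_j\in\mathbb N$ with $\lambda^n_i/n\to\lambda_i>0$, $N^n_j/n\to\nu_j>0$, $\mu^n_{ij}\to\mu_{ij}>0$, $(\lambda^n_i-n\lambda_i)/\sqrt n\to\hat\lambda_i$, $\sqrt n(\mu^n_{ij}-\mu_{ij})\to\hat\mu_{ij}$, $\sqrt n(N^n_j/n-\nu_j)\to\hat\nu_j$. Complete resource pooling: the LP ''minimize $\max_j\sum_i\xi_{ij}$ over nonnegative $\xi\in\mathbb R^{\mathcal G}$ subject to $\sum_j\mu_{ij}\nu_j\xi_{ij}=\lambda_i$ $\forall i$'' has a unique solution $\xi^*$, with $\sum_i\xi^*_{ij}=1$ $\forall j$, $\xi^*_{ij}>0$ for $i\sim j$; $z^*_{ij}:=\xi^*_{ij}\nu_j$; $\theta_j:=\hat\nu_j+\sum_{i\in\mathcal I(j)}(\hat\mu_{ij}/\mu_{ij})z^*_{ij}$.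 SWSS: $\vartheta_p$ is the (unique) optimal value of: maximize $\vartheta$ over $(\vartheta,\kappa)\in\mathbb R\times\mathbb R^{\mathcal G}$ subject to $\hat\lambda_i\le\sum_{j\in\mathcal J(i)}\mu_{ij}\kappa_{ij}-\vartheta p_i$ $\forall i$, $\sum_{i\in\mathcal I(j)}\kappa_{ij}=\theta_j$ $\forall j$. $N^n_{ij}$ are integers with $\lfloor\xi^*_{ij}N^n_j\rfloor\le N^n_{ij}\le\lceil\xi^*_{ij}N^n_j\rceil$ and $\sum_iN^n_{ij}=N^n_j$. $n$-th system: for $x\in\mathbb Z^I_+$, $\mathcal Z^n(x)=\{z\in\mathbb Z^{\mathcal G}_+:q_i\ge0,\ y_j\ge0,\ q_i\wedge y_j=0\ \forall(i,j)\in\mathcal E\}$ with $q_i=x_i-\sum_jz_{ij}$, $y_j=N^n_j-\sum_iz_{ij}$. Under a map $z:\mathbb Z^I_+\to\mathbb Z^{\mathcal G}_+$ with $z(x)\in\mathcal Z^n(x)$, $X^n$ is the continuous-time Markov chain with generator $\mathcal L^n_zf(x)=\sum_i\big(\lambda^n_i(f(x+e_i)-f(x))+\sum_{j\in\mathcal J(i)}\mu^n_{ij}z_{ij}(x)(f(x-e_i)-f(x))\big)$. Balanced saturation policies: with $\widetilde N^n_i:=\sum_{j\in\mathcal J(i)}\widetilde N^n_{ij}$, $\mathscr Z^n$ is the class of such work-conserving policies $z$ with, for each $i$: if $x_i\le\widetilde N^n_i$ then $z_{ij}(x)\le\widetilde N^n_{ij}$ for all $j\sim i$ and $\sum_{j\in\mathcal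 J(i)}z_{ij}(x)=x_i$; if $x_i>\widetilde N^n_i$ then $z_{ij}(x)\ge\widetilde N^n_{ij}$ for all $j\sim i$. Centering: $\tilde x^n_i(x):=(x_i-\widetilde N^n_i)/\sqrt n$. Lyapunov function: $V_\epsilon(y):=\exp\big(\epsilon|y|^2(1+|y|^2)^{-1/2}\big)$ for $y\in\mathbb R^I$, and $\widetilde V_\epsilon(x):=V_\epsilon(\tilde x^n(x))$. $\|\cdot\|_{\mathrm{TV}}$ is total variation norm. *)

(* Defs.v *)
From HB Require Import structures.
From mathcomp Require Import all_boot all_order all_algebra.
From mathcomp Require Import all_classical all_reals all_analysis.
Set Implicit Arguments. Unset Strict Implicit. Unset Printing Implicit Defensive.
Import Order.TTheory GRing.Theory Num.Theory.
Import numFieldNormedType.Exports.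
Local Open Scope ring_scope.
Local Open Scope classical_set_scope.

Definition state (I : nat) := {ffun 'I_I -> nat}.

Definition adjG I J (E : 'I_I -> 'I_J -> bool) : rel ('I_I + 'I_J) :=
  fun u v => match u, v with
             | inl i, inr j => E i j
             | inr j, inl i => E i j
             | _, _ => false end.

Definition is_tree I J (E : 'I_I -> 'I_J -> bool) : Prop :=
  (forall u v, connect (adjG E) u v) /\
  (#|[set ij : 'I_I * 'I_J | E ij.1 ij.2]| + 1 = I + J)%N.

Definition crp_feasible (R : realType) I J (E : 'I_I -> 'I_J -> bool)
  (lamL : 'I_I -> R) (muL : 'I_I -> 'I_J -> R) (nu : 'I_J -> R)
  (xi : 'I_I -> 'I_J -> R) : Prop :=
  (forall i j, ~~ E i j -> xi i j = 0) /\
  (forall i j, 0 <= xi i j) /\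
  (forall i, \sum_(j < J) muL i j * nu j * xi i j = lamL i).

Definition crp_obj (R : realType) I J (xi : 'I_I -> 'I_J -> R) : R :=
  \big[Num.max/0]_(j < J) \sum_(i < I) xi i j.

Definition crp_optimal (R : realType) I J (E : 'I_I -> 'I_J -> bool)
  lamL muL nu (xi : 'I_I -> 'I_J -> R) : Prop :=
  crp_feasible E lamL muL nu xi /\
  forall xi', crp_feasible E lamL muL nu xi' -> crp_obj xi <= crp_obj xi'.

Definition theta (R : realType) I J (E : 'I_I -> 'I_J -> bool)
  (muL muh : 'I_I -> 'I_J -> R) (nu nuh : 'I_J -> R)
  (xistar : 'I_I -> 'I_J -> R) (j : 'I_J) : R :=
  nuh j + \sum_(i < I | E i j) muh i j / muL i j * (xistar i j * nu j).

Definition swss_feasible (R : realType) I J (E : 'I_I -> 'I_J -> bool)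
  (lamh : 'I_I -> R) (muL muh : 'I_I -> 'I_J -> R) (nu nuh : 'I_J -> R)
  (xistar : 'I_I -> 'I_J -> R) (p : 'I_I -> R)
  (th : R) (kappa : 'I_I -> 'I_J -> R) : Prop :=
  (forall i j, ~~ E i j -> kappa i j = 0) /\
  (forall i, lamh i <= \sum_(j < J | E i j) muL i j * kappa i j - th * p i) /\
  (forall j, \sum_(i < I | E i j) kappa i j = theta E muL muh nu nuh xistar j).

Definition swss_value (R : realType) I J (E : 'I_I -> 'I_J -> bool)
  lamh muL muh nu nuh xistar (p : 'I_I -> R) (v : R) : Prop :=
  (exists kappa, swss_feasible E lamh muL muh nu nuh xistar p v kappa) /\
  (forall th kappa, swss_feasible E lamh muL muh nu nuh xistar p th kappa -> th <= v).

Definition policy I J := state I -> 'I_I -> 'I_J -> nat.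

Definition in_Zn I J (E : 'I_I -> 'I_J -> bool) (N : 'I_J -> nat)
  (x : state I) (zx : 'I_I -> 'I_J -> nat) : Prop :=
  (forall i j, ~~ E i j -> zx i j = 0%N) /\
  (forall i, (\sum_(j < J) zx i j <= x i)%N) /\
  (forall j, (\sum_(i < I) zx i j <= N j)%N) /\
  (forall i j, E i j ->
     minn (x i - \sum_(j' < J) zx i j') (N j - \sum_(i' < I) zx i' j) = 0%N).

Definition Ntil_i I J (E : 'I_I -> 'I_J -> bool) (Nt : 'I_I -> 'I_J -> int)
  (i : 'I_I) : int := \sum_(j < J | E i j) Nt i j.

Definition balanced I J (E : 'I_I -> 'I_J -> bool) (N : 'I_J -> nat)
  (Nt : 'I_I -> 'I_J -> int) (z : policy I J) : Prop :=
  (forall x : state I, in_Zn E N x (z x)) /\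
  (forall (x : state I) i,
     (((x i)%:Z <= Ntil_i E Nt i)%R ->
        (forall j, E i j -> ((z x i j)%:Z <= Nt i j)%R) /\
        (\sum_(j < J | E i j) z x i j = x i)%N) /\
     ((Ntil_i E Nt i < (x i)%:Z)%R ->
        forall j, E i j -> (Nt i j <= (z x i j)%:Z)%R)).

Definition e_up I (x : state I) (i : 'I_I) : state I :=
  [ffun k => if k == i then (x k).+1 else x k].
Definition e_down I (x : state I) (i : 'I_I) : state I :=
  [ffun k => if k == i then (x k).-1 else x k].

Definition gen (R : realType) I J (E : 'I_I -> 'I_J -> bool)
  (lam : 'I_I -> R) (mu : 'I_I -> 'I_J -> R) (z : policy I J)
  (f : state I -> R) (x : state I) : R :=
  \sum_(i < I) (lam i * (f (e_up x i) - f x) +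
     \sum_(j < J | E i j) mu i j * (z x i j)%:R * (f (e_down x i) - f x)).

Definition Veps (R : realType) I (eps : R) (y : 'I_I -> R) : R :=
  let s := \sum_(i < I) y i ^+ 2 in expR (eps * s / Num.sqrt (1 + s)).

Definition xtil (R : realType) I J (E : 'I_I -> 'I_J -> bool) (n : nat)
  (Nt : 'I_I -> 'I_J -> int) (x : state I) : 'I_I -> R :=
  fun i => ((x i)%:R - (Ntil_i E Nt i)%:~R) / Num.sqrt n%:R.

(* Powers of the (bounded-rate) Q-matrix: Q^0 = Id, Q^(k+1) = Q Q^k *)
Fixpoint Qpow (R : realType) I J (E : 'I_I -> 'I_J -> bool)
  (lam : 'I_I -> R) (mu : 'I_I -> 'I_J -> R) (z : policy I J)
  (k : nat) : state I -> state I -> R :=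
  match k with
  | 0 => fun x y => (x == y)%:R
  | k'.+1 => fun x y => gen E lam mu z (fun w => Qpow E lam mu z k' w y) x
  end.

Definition Ptrans (R : realType) I J (E : 'I_I -> 'I_J -> bool)
  (lam : 'I_I -> R) (mu : 'I_I -> 'I_J -> R) (z : policy I J)
  (t : R) (x y : state I) : R :=
  limn (fun K => \sum_(0 <= k < K) (t ^+ k / k`!%:R * Qpow E lam mu z k x y)).

Definition inv_prob (R : realType) I J (E : 'I_I -> 'I_J -> bool)
  (lam : 'I_I -> R) (mu : 'I_I -> 'I_J -> R) (z : policy I J)
  (pi : state I -> R) : Prop :=
  (forall x, 0 <= pi x) /\
  (\esum_(x in [set: state I]) (pi x)%:E = 1%E) /\
  (forall t, 0 <= t -> forall y,
     \esum_(x in [set: state I]) (pi x * Ptrans E lam mu z t x y)%:E = (pi y)%:E).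

Definition TVdist (R : realType) I (m1 m2 : state I -> R) : \bar R :=
  \esum_(y in [set: state I]) (`|m1 y - m2 y|)%:E.

Arguments xtil {R I J} E n Nt x.

(* Main.v *)
Require Import Defs.
From HB Require Import structures.
From mathcomp Require Import all_boot all_order all_algebra.
From mathcomp Require Import all_classical all_reals all_analysis.
From mathcomp Require Import ring lra.
Set Implicit Arguments.
Unset Strict Implicit.
Unset Printing Implicit Defensive.
Import Order.TTheory GRing.Theory Num.Theory.
Import numFieldNormedType.Exports.
Local Open Scope ring_scope.
Local Open Scope classical_set_scope.

(** Drift.  With r = sqrt (1 + |y|^2) the exponent of the Lyapunov function is
    eps (r - 1 / r), so concavity bounds its increments by the first order term
    and leaves an error of order eps^2.  Under a balanced saturation policy each
    coordinate y_i drifts towards 0: at speed at least vartheta p_i / 2 when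
    y_i > 0 (all targets are saturated), and linearly in |y_i| when y_i <= 0.
    Choosing eps small makes the first order term win outside a ball.

    Ergodicity.  The jump rates of each system are bounded, so P = 1 + Q / q is a
    lazy Markov operator for q large.  It satisfies the same Foster-Lyapunov
    condition, and all its powers of high order charge the empty state uniformly
    on sublevel sets of V; hence some power contracts the weighted oscillation
    sup |f x - f y| / (2 + b V x + b V y) (Hairer and Mattingly).  The semigroup
    exp (t Q) = exp (- q t) sum_j (q t)^j / j! P^j averages the powers of P with
    Poisson weights, which turns the geometric rate rho into the exponential
    rate q (1 - rho). *)

(** * Increments of the Lyapunov function *)

(** Inverting [exp (- u) >= 1 - u] gives [exp u <= 1 / (1 - u)], and [(1 - u) (1 + u + 2 u^2) = 1 +
    u^2 (1 - 2 u) >= 1]. *)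
Lemma expR_le_quad (R : realType) (u : R) : u <= 1 / 2 -> expR u <= 1 + u + 2 * u ^+ 2.
Proof.
move=> hu.
have h1 : 1 - u <= expR (- u) by exact: expR_ge1Dx.
have hp : 0 < 1 - u by lra.
rewrite -[u in expR u]opprK expRN.
apply: (@le_trans _ _ (1 - u)^-1); first by rewrite lef_pV2 ?posrE ?expR_gt0.
rewrite -[leLHS]mul1r ler_pdivrMr //.
have : 0 <= u ^+ 2 * (1 - 2 * u) by rewrite mulr_ge0 ?sqr_ge0 //; lra.
nra.
Qed.

(* In terms of r = sqrt (1 + s), the function s / sqrt (1 + s) is r - 1 / r,
   which is concave in r, while r is itself concave in s. *)
Lemma lyapunov_tangent (R : realType) (s s' r : R) : 0 <= s -> 0 <= s' ->
  r = Num.sqrt (1 + s) ->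
  s' / Num.sqrt (1 + s') <= s / r + (1 + r^-1 ^+ 2) * (s' - s) / (2 * r).
Proof.
move=> s0 s'0 rdef; set r' := Num.sqrt (1 + s').
have r0 : 0 < r by rewrite rdef sqrtr_gt0; lra.
have r'0 : 0 < r' by rewrite sqrtr_gt0; lra.
have rE : s = r ^+ 2 - 1 by rewrite rdef sqr_sqrtr; lra.
have r'E : s' = r' ^+ 2 - 1 by rewrite sqr_sqrtr; lra.
rewrite rE r'E -subr_ge0.
(* The gap to the tangent factors as a square times a positive quantity. *)
have -> : (r ^+ 2 - 1) / r + (1 + r^-1 ^+ 2) * (r' ^+ 2 - 1 - (r ^+ 2 - 1)) / (2 * r)
   - (r' ^+ 2 - 1) / r' =
   (r' - r) ^+ 2 * ((2 * r)^-1 + (r' + 2 * r) / (2 * r ^+ 3 * r')).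
  by field; rewrite !gt_eqF.
apply: mulr_ge0; first exact: sqr_ge0.
apply: addr_ge0; first by rewrite invr_ge0; lra.
by rewrite divr_ge0 ?mulr_ge0 ?exprn_ge0 //; lra.
Qed.

(** Here [u], the first order change of the exponent, satisfies [|u| <= 3 eps |d|] in every state
    because [|y| <= r]. Thus [eps <= 1 / 6] puts [u] in the range of [expR_le_quad], whose remainder
    [2 u^2] becomes [18 eps^2 d^2]. *)
Lemma lyapunov_increment (R : realType) (eps s s' r y d : R) : 0 < eps -> eps <= 1 / 6 ->
  y ^+ 2 <= s -> 0 <= s' -> s' = s + 2 * d * y + d ^+ 2 -> `|d| <= 1 ->
  r = Num.sqrt (1 + s) ->
  expR (eps * s' / Num.sqrt (1 + s')) <=
  expR (eps * s / r) *
    (1 + (eps * (1 + r^-1 ^+ 2) / (2 * r) * (2 * d * y + d ^+ 2) + 18 * eps ^+ 2 * d ^+ 2)).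
Proof.
move=> e0 e1 ys s'0 s'E d1 rdef.
have s0 : 0 <= s by apply: le_trans ys; exact: sqr_ge0.
have r1 : 1 <= r by rewrite rdef -{1}sqrtr1 ler_sqrt; lra.
have r0 : 0 < r by lra.
have yr : `|y| <= r.
  by rewrite -sqrtr_sqr rdef ler_sqrt; lra.
set u := eps * (1 + r^-1 ^+ 2) / (2 * r) * (2 * d * y + d ^+ 2).
have ub : `|u| <= 3 * eps * `|d|.
  have -> : u = eps * (((1 + r^-1 ^+ 2) / 2) * (2 * d * (y / r) + d ^+ 2 / r)).
    by rewrite /u; field; rewrite gt_eqF.
  have ri1 : r^-1 <= 1 by rewrite invf_le1.
  have ri0 : 0 < r^-1 by rewrite invr_gt0.
  have a1 : `|(1 + r^-1 ^+ 2) / 2| <= 1 by rewrite ger0_norm; nra.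
  have a2 : `|2 * d * (y / r) + d ^+ 2 / r| <= 3 * `|d|.
    apply: le_trans (ler_normD _ _) _.
    have b1 : `|y / r| <= 1 by rewrite normrM (gtr0_norm ri0) ler_pdivrMr // mul1r.
    have b2 : `|d ^+ 2 / r| <= `|d|.
      rewrite normrM (gtr0_norm ri0) normrX.
      have := normr_ge0 d; nra.
    have b3 : `|2 * d * (y / r)| <= 2 * `|d|.
      rewrite !normrM (ger0_norm (_ : 0 <= 2)) // -normrM.
      by rewrite ler_piMr // mulr_ge0.
    lra.
  rewrite normrM (gtr0_norm e0) normrM.
  have : `|(1 + r^-1 ^+ 2) / 2| * `|2 * d * (y / r) + d ^+ 2 / r| <= 1 * (3 * `|d|).
    by apply: ler_pM.
  nra.
have d0 := normr_ge0 d.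
have u2 : u <= 1 / 2.
  apply: le_trans (ler_norm u) _; nra.
have usq : u ^+ 2 <= 9 * eps ^+ 2 * d ^+ 2.
  rewrite -[u ^+ 2]ger0_norm ?sqr_ge0 // normrX.
  have -> : 9 * eps ^+ 2 * d ^+ 2 = (3 * eps * `|d|) ^+ 2.
    by rewrite !exprMn real_normK ?num_real //; ring.
  by rewrite lerXn2r // ?nnegrE // !mulr_ge0 // ltW.
apply: (@le_trans _ _ (expR (eps * s / r + u))).
  rewrite ler_expR.
  have := lyapunov_tangent s0 s'0 rdef => H.
  rewrite -!mulrA /u.
  have -> : eps * (s / r) + eps * (1 + r^-1 ^+ 2) / (2 * r) * (2 * d * y + d ^+ 2) =
     eps * (s / r + (1 + r^-1 ^+ 2) * (s' - s) / (2 * r)).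
    by rewrite s'E; field; rewrite gt_eqF.
  by rewrite ler_pM2l.
rewrite expRD ler_pM2l ?expR_gt0 //.
have := expR_le_quad u2; rewrite -/u; lra.
Qed.

(** In the application [h] is the jump size [1 / sqrt n], [K2] bounds the scaled total rates and
    [K1 - c |y_i|] the scaled drifts. The hypothesis on [Vm] carries the factor [b i] because a
    downward jump from an empty class does not shift the state, but then has rate 0. *)
Lemma drift_combine (R : realType) (I : nat) (eps c K1 K2 h s V C3 : R)
    (y lam b : 'I_I -> R) (Vp Vm : 'I_I -> R) :
  0 < c -> 0 <= K1 -> 0 <= K2 -> 0 < eps -> eps <= 1 / 6 ->
  18 * I%:R * K2 * eps <= c / 4 -> 0 < h -> h <= 1 ->
  (forall i, 0 <= lam i) -> (forall i, 0 <= b i) ->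
  (forall i, h ^+ 2 * (lam i + b i) <= K2) ->
  (forall i, h * (y i * (lam i - b i)) <= K1 - c * `|y i|) ->
  s = \sum_(i < I) y i ^+ 2 -> V = expR (eps * s / Num.sqrt (1 + s)) ->
  C3 = c + I%:R * (K1 + K2) ->
  (forall i, Vp i <= expR (eps * (s + 2 * h * y i + h ^+ 2) / Num.sqrt (1 + (s + 2 * h * y i + h ^+ 2)))) ->
  (forall i, b i * Vm i <= b i * expR (eps * (s - 2 * h * y i + h ^+ 2) / Num.sqrt (1 + (s - 2 * h * y i + h ^+ 2)))) ->
  \sum_(i < I) (lam i * (Vp i - V) + b i * (Vm i - V)) <=
    eps * (2 * C3 + c) * expR (8 * C3 / c) - eps * c / 2 * V.
Proof.
move=> c0 K10 K20 e0 e1 eK h0 h1 lam0 b0 hK2 hK1 sE VE0 C3E hVp hVm.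
have ysq i : y i ^+ 2 <= s.
  by rewrite sE (bigD1 i) //= lerDl sumr_ge0 // => k _; exact: sqr_ge0.
have s0 : 0 <= s by rewrite sE sumr_ge0 // => k _; exact: sqr_ge0.
pose r := Num.sqrt (1 + s).
have r1 : 1 <= r by rewrite /r -{1}sqrtr1 ler_sqrt; lra.
have r0 : 0 < r by lra.
have V0 : 0 < V by rewrite VE0; exact: expR_gt0.
have sr : s = r ^+ 2 - 1 by rewrite sqr_sqrtr; lra.
have C30 : 0 < C3 by rewrite C3E ltr_pwDl // mulr_ge0 // addr_ge0.
have spos d i : `|d| <= 1 -> 0 <= s + 2 * d * y i + d ^+ 2.
  move=> _; have := ysq i; have := sqr_ge0 (y i + d); nra.
pose g := eps * (1 + r^-1 ^+ 2) / (2 * r).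
have g0 : 0 <= g.
  rewrite /g divr_ge0 ?mulr_ge0 ?addr_ge0 ?exprn_ge0 ?invr_ge0 //; exact: ltW.
have main : \sum_(i < I) (lam i * (Vp i - V) + b i * (Vm i - V)) <=
   V * \sum_(i < I) (g * (2 * (K1 - c * `|y i|) + K2) + 18 * eps ^+ 2 * K2).
  rewrite mulr_sumr; apply: ler_sum => i _.
  have hn : `|h| <= 1 by rewrite gtr0_norm.
  have hn' : `|- h| <= 1 by rewrite normrN gtr0_norm.
  have P := lyapunov_increment e0 e1 (ysq i) (spos h i hn) erefl hn erefl.
  have M := lyapunov_increment e0 e1 (ysq i) (spos (- h) i hn') erefl hn' erefl.
  move: P M; rewrite /= -/r -/g -VE0 => P M.
  have hm : s + 2 * - h * y i + (- h) ^+ 2 = s - 2 * h * y i + h ^+ 2 by ring.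
  rewrite hm in M.
  have A1 := ler_wpM2l (lam0 i) (le_trans (hVp i) P).
  have A2 := le_trans (hVm i) (ler_wpM2l (b0 i) M).
  apply: (@le_trans _ _ (V * (g * (2 * (h * (y i * (lam i - b i))) + h ^+ 2 * (lam i + b i))
           + 18 * eps ^+ 2 * (h ^+ 2 * (lam i + b i))))).
    rewrite !mulrBr.
    apply: (@le_trans _ _ (lam i * (V * (1 + (g * (2 * h * y i + h ^+ 2) + 18 * eps ^+ 2 * h ^+ 2))) - lam i * V +
      (b i * (V * (1 + (g * (2 * - h * y i + (- h) ^+ 2) + 18 * eps ^+ 2 * (- h) ^+ 2))) - b i * V))).
      by rewrite lerD // lerB.
    by rewrite le_eqVlt; apply/orP; left; apply/eqP; ring.
  rewrite ler_pM2l // lerD // ?ler_wpM2l ?lerD ?ler_wpM2l ?hK1 ?hK2 //.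
  by rewrite mulr_ge0 ?sqr_ge0.
apply: (le_trans main).
(* The sum of the [|y_i|] dominates the Euclidean norm, and [s = r^2 - 1 >= (r - 1)^2] since
   [r >= 1]. *)
have sumy : r - 1 <= \sum_(i < I) `|y i|.
  have yy : s <= (\sum_(i < I) `|y i|) ^+ 2.
    rewrite expr2 mulr_suml sE; apply: ler_sum => i _.
    rewrite -[y i ^+ 2]ger0_norm ?sqr_ge0 // normrX expr2 ler_wpM2l //.
    by rewrite (bigD1 i) //= lerDl sumr_ge0.
  have t0 : 0 <= \sum_(i < I) `|y i| by rewrite sumr_ge0.
  nra.
rewrite big_split /= -mulr_sumr big_split /= -mulr_sumr sumrB -mulr_sumr.
rewrite !sumr_const card_ord -[K1 *+ I]mulr_natl -[K2 *+ I]mulr_natl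
  -[_ * K2 *+ I]mulr_natl.
set Y := \sum_(i < I) `|y i| in sumy *.
(* The second order error uses up a quarter of [c]. The rest equals
   [eps (1 + 1 / r^2) (C3 / r - c)], which is at most [eps (2 C3 / r - c)]. *)
have step : g * (2 * (I%:R * K1 - c * Y) + I%:R * K2) + I%:R * (18 * eps ^+ 2 * K2) <=
   eps * (2 * C3 / r - 3 / 4 * c).
  have B1 : 2 * (I%:R * K1 - c * Y) + I%:R * K2 <= 2 * (C3 - c * r).
    have : 0 <= I%:R * K2 by rewrite mulr_ge0.
    have : c * (r - 1) <= c * Y by rewrite ler_pM2l.
    rewrite C3E; lra.
  have B2 := ler_wpM2l g0 B1.
  have B3 : I%:R * (18 * eps ^+ 2 * K2) <= eps * (c / 4).
    by have := ler_wpM2l (ltW e0) eK; lra.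
  have B4 : g * (2 * (C3 - c * r)) <= eps * (2 * C3 / r - c).
    have -> : g * (2 * (C3 - c * r)) = eps * ((1 + r^-1 ^+ 2) * (C3 / r - c)).
      by rewrite /g; field; rewrite gt_eqF.
    rewrite ler_pM2l //.
    have ri1 : r^-1 <= 1 by rewrite invf_le1.
    have ri0 : 0 < r^-1 by rewrite invr_gt0.
    have q1 : 0 <= r^-1 ^+ 2 by exact: sqr_ge0.
    have q2 : r^-1 ^+ 2 <= 1 by rewrite expr_le1 // ltW.
    have A0 : 0 <= C3 / r by rewrite divr_ge0 // ltW.
    have : r^-1 ^+ 2 * (C3 / r) <= C3 / r by rewrite ler_piMl.
    have : 0 <= r^-1 ^+ 2 * c by rewrite mulr_ge0 // ltW.
    lra.
  lra.
apply: (le_trans (ler_wpM2l (ltW V0) step)).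
(* Beyond this radius [2 C3 / r <= c / 4], so a decay of at least [eps c / 2] is left. Inside, the
   exponent of [V] is at most [r], hence [V] is bounded by the constant [expR (8 * C3 / c)]. *)
have [hr|hr] := leP (8 * C3 / c) r.
  have k1 : 2 * C3 / r <= c / 4.
    rewrite ler_pdivrMr // ; move: hr; rewrite ler_pdivrMr //; lra.
  have k2 : 0 <= eps * (2 * C3 + c) * expR (8 * C3 / c).
    by rewrite !mulr_ge0 ?expR_ge0 ?addr_ge0 ?mulr_ge0 // ltW.
  have : V * (eps * (2 * C3 / r - 3 / 4 * c)) <= V * (eps * (- (c / 2))).
    rewrite !ler_pM2l //; lra.
  lra.
have k1 : 2 * C3 / r <= 2 * C3 by rewrite ler_pdivrMr // ler_peMr //; lra.
have VE : V <= expR (8 * C3 / c).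
  rewrite VE0 ler_expR -/r.
  apply: (@le_trans _ _ (1 * r)); last by rewrite mul1r ltW.
  rewrite ler_pdivrMr //.
  have E1 : eps * s <= 1 * s by rewrite ler_wpM2r //; lra.
  by rewrite -mulrA -expr2; lra.
have k2 : V * (eps * (2 * C3 / r - 3 / 4 * c)) <= V * (eps * (2 * C3)).
  rewrite !ler_pM2l //; lra.
have k3 := ler_wpM2l (_ : 0 <= eps * (2 * C3 + c)) VE.
have k4 : 0 <= eps * (2 * C3 + c) by rewrite mulr_ge0 // ?addr_ge0 ?mulr_ge0 // ltW.
have := k3 k4.
have : 0 <= eps * V * c by rewrite !mulr_ge0 // ltW.
lra.
Qed.

(** * Markov operators and their weighted contraction *)

(** The operator acts on all functions, so the unbounded [V] needs no integrability condition.
    Continuity under plain pointwise limits is realistic here: from each state the chain jumps to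
    finitely many others. *)
Record markov_op (R : realType) (S : Type) (P : (S -> R) -> S -> R) : Prop := MarkovOp {
  mop_lin : forall a f g x, P (fun u => a * f u + g u) x = a * P f x + P g x ;
  mop_ge0 : forall f, (forall x, 0 <= f x) -> forall x, 0 <= P f x ;
  mop_cst : forall c x, P (fun=> c) x = c ;
  mop_cvg : forall (u : nat -> S -> R) f, (forall x, u n x @[n --> \oo] --> f x) ->
    forall x, P (u n) x @[n --> \oo] --> P f x }.

Section MarkovOperator.
Variables (R : realType) (S : Type) (P : (S -> R) -> S -> R).
Hypothesis mP : markov_op P.

Lemma mopD f g x : P (fun u => f u + g u) x = P f x + P g x.
Proof.
rewrite -[P f x]mul1r -(mop_lin mP); congr (P _ x); apply/funext => u.
by rewrite mul1r.
Qed.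

Lemma mopZ a f x : P (fun u => a * f u) x = a * P f x.
Proof.
rewrite -[RHS]addr0 -[X in _ = _ + X](mop_cst mP 0 x) -(mop_lin mP); congr (P _ x).
by apply/funext => u; rewrite addr0.
Qed.

Lemma mopB f g x : P (fun u => f u - g u) x = P f x - P g x.
Proof.
rewrite mopD -[- P g x]mulN1r -mopZ; congr (_ + P _ x).
by apply/funext => u; rewrite mulN1r.
Qed.

Lemma mop_le f g : (forall x, f x <= g x) -> forall x, P f x <= P g x.
Proof.
move=> fg x; rewrite -subr_ge0 -mopB; apply: (mop_ge0 mP) => u.
by rewrite subr_ge0.
Qed.

Lemma mop_aff a b f x : P (fun u => a + b * f u) x = a + b * P f x.
Proof. by rewrite mopD mopZ (mop_cst mP). Qed.

Lemma mop_norm f g : (forall x, `|f x| <= g x) -> forall x, `|P f x| <= P g x.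
Proof.
move=> fg x; rewrite ler_norml -[- P g x]mulN1r -mopZ; apply/andP; split.
  by apply: mop_le => u; have := fg u; rewrite ler_norml mulN1r => /andP[].
by apply: mop_le => u; exact: le_trans (ler_norm _) (fg u).
Qed.

Lemma mop_sum (T : Type) (s : seq T) (c : T -> R) (f : T -> S -> R) x :
  P (fun u => \sum_(t <- s) c t * f t u) x = \sum_(t <- s) c t * P (f t) x.
Proof.
elim: s => [|t s IHs].
  rewrite big_nil -[RHS](mop_cst mP 0 x); congr (P _ x).
  by apply/funext => u; rewrite big_nil.
rewrite big_cons -IHs -(mop_lin mP); congr (P _ x).
by apply/funext => u; rewrite big_cons.
Qed.

Lemma markov_iter k : markov_op (iter k P).
Proof.
elim: k => [|k IHk]; first by split => //= f g h.
split=> [a f g x|f f0 x|c x|u f uf x] /=.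
- rewrite -(mop_lin mP); congr (P _ x); apply/funext => v; exact: (mop_lin IHk).
- by apply: (mop_ge0 mP) => v; exact: (mop_ge0 IHk).
- rewrite -[RHS](mop_cst mP c x); congr (P _ x); apply/funext => v.
  exact: (mop_cst IHk).
- by apply: (mop_cvg mP) => v; exact: (mop_cvg IHk).
Qed.

End MarkovOperator.

Section Lyapunov.
Variables (R : realType) (S : Type) (P : (S -> R) -> S -> R).
Hypothesis mP : markov_op P.
Variables (V : S -> R) (g K : R).
Hypotheses (V0 : forall x, 0 <= V x) (g0 : 0 <= g) (g1 : g < 1) (K0 : 0 <= K).
Hypothesis PV : forall x, P V x <= g * V x + K.

(** The constant [K / (1 - g)] is the fixed point of [c = K + g c], so one bound serves every
    positive power. Keeping [g] in place of [g ^+ k] suffices, as only [g < 1] matters for the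
    contraction. *)
Lemma iter_lyapunov k x : (0 < k)%N -> iter k P V x <= g * V x + K / (1 - g).
Proof.
have d0 : 0 < 1 - g by rewrite subr_gt0.
have KK : K <= K / (1 - g) by rewrite ler_pdivlMr // ler_piMr // gerBl.
case: k => // k _; elim: k x => [|k IHk] x.
  by apply: le_trans (PV x) _; rewrite lerD2l.
have mPk := markov_iter mP k.+1.
rewrite iterSr; apply: (@le_trans _ _ (K + g * iter k.+1 P V x)).
  rewrite -(mop_aff mPk); apply: (mop_le mPk) => u.
  by rewrite addrC.
have := ler_wpM2l g0 (IHk x).
have E : K / (1 - g) = K + g * (K / (1 - g)) by field; rewrite gt_eqF.
have : g * (g * V x) <= g * V x.
  by rewrite ler_wpM2l // ler_piMl // ltW.
lra.
Qed.

Lemma iter_lyapunov0 k x : iter k P V x <= V x + K / (1 - g).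
Proof.
case: k => [|k]; first by rewrite /= lerDl divr_ge0 // subr_ge0 ltW.
apply: (le_trans (iter_lyapunov _ (ltn0Sn k))).
by rewrite lerD2r ler_piMl // ltW.
Qed.

End Lyapunov.

Section Contraction.
Variables (R : realType) (S : Type).

(* The positive functionals A and B act on the two coordinates separately. *)
Lemma double_average_le (A B : (S -> R) -> R) (a : R) (V phi : S -> R) (c b : R) :
  (forall f g, (forall x, f x <= g x) -> A f <= A g) ->
  (forall f g, (forall x, f x <= g x) -> B f <= B g) ->
  (forall u v f, A (fun x => u + v * f x) = a * u + v * A f) ->
  (forall u v f, B (fun x => u + v * f x) = a * u + v * B f) ->
  0 < a ->
  (forall x y, phi x - phi y <= c * (2 + b * V x + b * V y)) ->
  A phi - B phi <= c * (2 * a + b * A V + b * B V).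
Proof.
move=> Ale Ble Aaff Baff a0 H.
have H1 y : A phi - a * phi y <= c * (2 * a + b * A V + a * (b * V y)).
  have := Ale (fun x => - phi y + 1 * phi x)
     (fun x => c * (2 + b * V y) + (c * b) * V x).
  rewrite !Aaff => h; have {h}h := h _.
  have : forall x, - phi y + 1 * phi x <= c * (2 + b * V y) + c * b * V x.
    by move=> x; have := H x y; lra.
  by move/h; lra.
have := Ble (fun y => A phi + (- a) * phi y)
  (fun y => c * (2 * a + b * A V) + (c * a * b) * V y).
have h : forall y, A phi + (- a) * phi y <= c * (2 * a + b * A V) + c * a * b * V y.
  by move=> y; have := H1 y; lra.
move/(_ h); rewrite !Baff => h'.
rewrite -(ler_pM2l a0); lra.
Qed.

(** For large [V x + V y] the Lyapunov inequality contracts the weight; otherwise both averages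
    share the mass [d] at [o], which cancels. The choice [b * (2 * K + 1) = d] makes the gain [d]
    pay for the growth [2 * b * K], and the extra 1 leaves the spare [b] behind the rate
    [1 - b / 2]. *)
Lemma oscillation_contraction (P : (S -> R) -> S -> R) (V : S -> R) (g K d b r : R) (o : S) :
  markov_op P -> (forall x, 0 <= V x) -> 0 <= g -> g < 1 -> 0 <= K ->
  (forall x, P V x <= g * V x + K) -> 0 < d -> d < 1 ->
  (forall x f, V x <= 2 * (2 * K + 1) / (1 - g) -> (forall u, 0 <= f u) ->
     d * f o <= P f x) ->
  b = d / (2 * K + 1) -> r = Num.max ((1 + g) / 2) (1 - b / 2) ->
  forall (c : R) phi, 0 <= c ->
  (forall x y, `|phi x - phi y| <= c * (2 + b * V x + b * V y)) ->
  forall x y, `|P phi x - P phi y| <= r * c * (2 + b * V x + b * V y).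
Proof.
move=> mP V0 g0 g1 K0 PV d0 d1 minor bE rE c phi c0 H.
have K1 : 0 < 2 * K + 1 by lra.
have b0 : 0 < b by rewrite bE divr_gt0.
have bK : b * (2 * K + 1) = d by rewrite bE divfK // gt_eqF.
have bd : b <= d by nra.
have r1 : (1 + g) / 2 <= r by rewrite rE le_max lexx.
have r2 : 1 - b / 2 <= r by rewrite rE le_max lexx orbT.
have H' x y : phi x - phi y <= c * (2 + b * V x + b * V y).
  exact: le_trans (ler_norm _) (H x y).
suff main x y : P phi x - P phi y <= r * c * (2 + b * V x + b * V y).
  move=> x y; rewrite ler_norml main andbT lerNl opprB.
  by have := main y x; lra.
have W0 : 0 <= V x + V y by rewrite addr_ge0.
have PVx := PV x; have PVy := PV y.
have [hW|hW] := leP (2 * (2 * K + 1) / (1 - g)) (V x + V y).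
  have E : P phi x - P phi y <= c * (2 * 1 + b * P V x + b * P V y).
    apply: (@double_average_le (fun f => P f x) (fun f => P f y)) => //.
    - by move=> f h fh; apply: mop_le.
    - by move=> f h fh; apply: mop_le.
    - by move=> u v f; rewrite mop_aff // mul1r.
    - by move=> u v f; rewrite mop_aff // mul1r.
  apply: (le_trans E); rewrite [r * c]mulrC -mulrA; apply: ler_wpM2l => //.
  have h1 : b * (2 * K + 1) <= b * ((1 - g) / 2 * (V x + V y)).
    apply: ler_wpM2l; first exact: ltW.
    move: hW; rewrite ler_pdivrMr ?subr_gt0 //; lra.
  have h2 : 1 * r + b * ((1 + g) / 2 * (V x + V y)) <= r + b * (r * (V x + V y)).
    by rewrite mul1r lerD2l; apply: ler_wpM2l; [exact: ltW|exact: ler_wpM2r].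
  have h3 : b * (P V x + P V y) <= b * (g * (V x + V y) + 2 * K).
    apply: ler_wpM2l; [exact: ltW|lra].
  lra.
have Vx : V x <= 2 * (2 * K + 1) / (1 - g) by have := V0 y; lra.
have Vy : V y <= 2 * (2 * K + 1) / (1 - g) by have := V0 x; lra.
(* By the minorization, [f] maps to [P f x - d * f o] positively, with total mass [1 - d], and
   likewise at [y]. *)
have E : (P phi x - d * phi o) - (P phi y - d * phi o) <=
   c * (2 * (1 - d) + b * (P V x - d * V o) + b * (P V y - d * V o)).
  apply: (@double_average_le (fun f => P f x - d * f o) (fun f => P f y - d * f o)) => //.
  - move=> f h fh; have := minor x (fun u => h u - f u) Vx.
    rewrite mopB // => k.
    have : forall u, 0 <= h u - f u by move=> u; rewrite subr_ge0.
    by move/k; lra.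
  - move=> f h fh; have := minor y (fun u => h u - f u) Vy.
    rewrite mopB // => k.
    have : forall u, 0 <= h u - f u by move=> u; rewrite subr_ge0.
    by move/k; lra.
  - by move=> u v f; rewrite mop_aff //; ring.
  - by move=> u v f; rewrite mop_aff //; ring.
  - by rewrite subr_gt0.
have {E} E : P phi x - P phi y <= c * (2 * (1 - d) + b * (P V x - d * V o) + b * (P V y - d * V o)).
  by move: E; lra.
apply: (le_trans E); rewrite [r * c]mulrC -mulrA; apply: ler_wpM2l => //.
have o0 : 0 <= b * (d * V o) by rewrite !mulr_ge0 // ltW.
have h3 : b * (P V x + P V y) <= b * (g * (V x + V y) + 2 * K).
  apply: ler_wpM2l; [exact: ltW|lra].
have h2 : b * (g * (V x + V y)) <= b * (r * (V x + V y)).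
  by apply: ler_wpM2l; [exact: ltW|apply: ler_wpM2r => //; lra].
lra.
Qed.

End Contraction.

(** * Limits and geometric bounds for real sequences *)

Section RealSequences.
Variable R : realType.
Implicit Types (u v : nat -> R) (l m c r : R).

Lemma cvgn_le u v l m : u n @[n --> \oo] --> l -> v n @[n --> \oo] --> m ->
  (\forall n \near \oo, u n <= v n) -> l <= m.
Proof.
move=> ul vm uv; rewrite -(cvg_lim (@Rhausdorff R) ul) -(cvg_lim (@Rhausdorff R) vm).
by apply: ler_lim => //; [apply: cvgP; exact: ul|apply: cvgP; exact: vm].
Qed.

Lemma cvgn_sum (T : Type) (s : seq T) (u : T -> nat -> R) (l : T -> R) :
  (forall y, u y n @[n --> \oo] --> l y) ->
  \sum_(y <- s) u y n @[n --> \oo] --> \sum_(y <- s) l y.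
Proof. by move=> ul; apply: cvg_big => //; exact: add_continuous. Qed.

Lemma geometric_lt r c e : 0 <= r -> r < 1 -> 0 < e -> exists k, c * r ^+ k < e.
Proof.
move=> r0 r1 e0.
have : c * r ^+ k @[k --> \oo] --> c * 0.
  by apply: cvgMr; apply: cvg_expr; rewrite ger0_norm.
rewrite mulr0 => /cvgrPdist_lt /(_ _ e0)[N _ /(_ N (leqnn N))] /=.
rewrite sub0r normrN => h; exists N; exact: le_lt_trans (ler_norm _) h.
Qed.

Lemma geometric_cauchy_cvg u c r : 0 <= r -> r < 1 ->
  (forall k j, `|u (k + j)%N - u k| <= c * r ^+ k) -> cvgn u.
Proof.
move=> r0 r1 H; apply/cauchy_cvgP; apply: cauchy_exP => e e0.
have [k hk] := geometric_lt c r0 r1 e0.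
exists (u k); exists k => // n /= kn.
rewrite /ball /= distrC -(subnKC kn); exact: le_lt_trans (H _ _) hk.
Qed.

Lemma bernoulli_inequality (a : R) n : 0 <= a -> a <= 1 -> 1 - n%:R * a <= (1 - a) ^+ n.
Proof.
move=> a0 a1; elim: n => [|n IHn]; first by rewrite mul0r subr0 expr0.
rewrite exprS; apply: (@le_trans _ _ ((1 - a) * (1 - n%:R * a))).
  rewrite -natr1; have : 0 <= n%:R * a ^+ 2 :> R by rewrite mulr_ge0 ?sqr_ge0.
  lra.
by rewrite ler_wpM2l // subr_ge0.
Qed.

End RealSequences.

Section Geometric.
Variables (R : realType) (S : Type) (P : (S -> R) -> S -> R) (V : S -> R) (g K : R) (o : S).
Hypotheses (mP : markov_op P) (V0 : forall x, 0 <= V x) (g0 : 0 <= g) (g1 : g < 1)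
  (K0 : 0 <= K) (PV : forall x, P V x <= g * V x + K).
Hypothesis minor : forall L, exists m0, forall m, (m0 <= m)%N -> exists2 d : R, 0 < d &
  forall x (f : S -> R), V x <= L -> (forall u, 0 <= f u) -> d * f o <= iter m P f x.

(** A fixed power [iter m P] contracts the weighted oscillation by a factor [q]. Euclidean division
    of [k] by [m] gives a rate per single step, the remaining steps costing at most the constant
    [(r ^+ m)^-1]. *)
Lemma geometric_contraction : exists r C, [/\ 0 < r, r < 1, 0 <= C &
  forall phi, (forall x, `|phi x| <= 1) -> forall k x y,
    `|iter k P phi x - iter k P phi y| <= C * r ^+ k * (1 + V x + V y)].
Proof.
have g1' := g1; have g0' := g0; have K0' := K0.
pose K' := K / (1 - g).
have K'0 : 0 <= K' by rewrite divr_ge0 // subr_ge0 ltW.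
have [m0 /(_ (maxn m0 1) (leq_maxl _ _))[d' d'0 minor']] :=
  minor (2 * (2 * K' + 1) / (1 - g)).
set m := maxn m0 1 in minor'.
have m1 : (0 < m)%N by rewrite leq_max orbT.
(* The contraction lemma requires [d < 1]. *)
pose d := Num.min d' (1 / 2).
have d0 : 0 < d by rewrite lt_min d'0 divr_gt0.
have d1 : d < 1 by rewrite gt_min; apply/orP; right; lra.
have [b [q [b0 q0 q1 H]]] : exists b q, [/\ 0 < b, 0 < q, q < 1 &
    forall (c : R) phi, 0 <= c -> (forall x y, `|phi x - phi y| <= c * (2 + b * V x + b * V y)) ->
    forall x y, `|iter m P phi x - iter m P phi y| <= q * c * (2 + b * V x + b * V y)].
  exists (d / (2 * K' + 1)), (Num.max ((1 + g) / 2) (1 - d / (2 * K' + 1) / 2)).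
  have b0 : 0 < d / (2 * K' + 1) by rewrite divr_gt0 //; lra.
  split => //.
  - by rewrite lt_max; apply/orP; left; lra.
  - by rewrite gt_max; apply/andP; split; lra.
  have PmV x : iter m P V x <= g * V x + K' by exact: iter_lyapunov.
  apply: (@oscillation_contraction _ _ (iter m P) V g K' d _ _ o (markov_iter mP m) V0 g0 g1 K'0 PmV
    d0 d1 _ erefl erefl) => x f Vx f0.
  by apply: le_trans (minor' x f Vx f0); rewrite ler_wpM2r // ge_min lexx.
have Hq n phi : (forall x, `|phi x| <= 1) -> forall x y,
    `|iter n (iter m P) phi x - iter n (iter m P) phi y| <= q ^+ n * (2 + b * V x + b * V y).
  move=> phi1; elim: n => [|n IHn] x y.
    rewrite expr0 mul1r /=; apply: le_trans (ler_normB _ _) _.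
    have := phi1 x; have := phi1 y.
    have : 0 <= b * V x by rewrite mulr_ge0 // ltW.
    have : 0 <= b * V y by rewrite mulr_ge0 // ltW.
    lra.
  rewrite exprS /=; apply: H => //; rewrite exprn_ge0 //; exact: ltW.
(* This stands in for the [m]-th root of [q]: Bernoulli's inequality gives [q <= r ^+ m]. *)
pose r := 1 - (1 - q) / m%:R.
have mR : 1 <= m%:R :> R by rewrite ler1n.
have a0 : 0 < (1 - q) / m%:R by rewrite divr_gt0 //; lra.
have a1 : (1 - q) / m%:R < 1 by rewrite ltr_pdivrMr; lra.
have r0 : 0 < r by rewrite subr_gt0.
have qr : q <= r ^+ m.
  have := bernoulli_inequality m (ltW a0) (ltW a1).
  rewrite mulrC divfK ?pnatr_eq0 -?lt0n // -/r; lra.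
have r1 : r < 1 by rewrite /r; lra.
exists r, ((r ^+ m)^-1 * (2 + b)); split => //.
  apply: mulr_ge0; last by apply: addr_ge0 => //; exact: ltW.
  by rewrite invr_ge0; apply: exprn_ge0; exact: ltW.
move=> phi phi1 k x y.
rewrite (divn_eq k m) iterD iterM.
have phi1' u : `|iter (k %% m) P phi u| <= 1.
  have mPk := markov_iter mP (k %% m).
  have := mop_norm mPk phi1 u; by rewrite (mop_cst mPk).
apply: (le_trans (Hq _ _ phi1' x y)).
have W0 : 0 <= V x + V y by rewrite addr_ge0.
have e1 : q ^+ (k %/ m) <= (r ^+ m)^-1 * r ^+ (k %/ m * m + k %% m).
  have e2 : r ^+ m <= r ^+ (k %% m).
    by apply: ler_wiXn2l; [exact: ltW|exact: ltW|apply/ltnW/ltn_pmod].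
  rewrite ler_pdivlMl ?exprn_gt0 // exprD mulrC.
  apply: ler_pM; rewrite ?exprn_ge0 ?(ltW q0) ?(ltW r0) //.
  by rewrite mulnC exprM lerXn2r // ?nnegrE ?exprn_ge0 // ltW.
rewrite -[X in _ <= X]mulrA [in X in _ <= X]mulrA.
apply: (@le_trans _ _ ((r ^+ m)^-1 * r ^+ (k %/ m * m + k %% m) * (2 + b * V x + b * V y))).
  apply: ler_wpM2r => //; have := mulr_ge0 (ltW b0) W0; lra.
have z0 : 0 <= (r ^+ m)^-1 * r ^+ (k %/ m * m + k %% m).
  by rewrite mulr_ge0 ?invr_ge0 ?exprn_ge0 // ltW.
have := ler_wpM2l z0 (_ : 2 + b * V x + b * V y <= (2 + b) * (1 + V x + V y)).
have e3 : 2 + b * V x + b * V y <= (2 + b) * (1 + V x + V y) by lra.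
by move/(_ e3); lra.
Qed.

End Geometric.

(** * Poisson averages of the powers of a Markov operator *)

Section ExponentialSeries.
Variable R : realType.
Implicit Types (t c M : R) (F G : nat -> nat -> R).

Lemma expR_cvg t : (fun n => \sum_(0 <= k < n) t ^+ k / k`!%:R) @ \oo --> expR t.
Proof.
have := is_cvg_series_exp_coeff t; rewrite -/(expR t) => h.
exact: h.
Qed.

Lemma exp_coeffS t (k : nat) : k.+1%:R * (t ^+ k.+1 / k.+1`!%:R) = t * (t ^+ k / k`!%:R).
Proof.
rewrite factS natrM exprS; field.
by rewrite nat1r !pnatr_eq0 -!lt0n fact_gt0.
Qed.

(** Leibniz rule for power series: the sums are the coefficients of the product of [exp (t s)] with
    the series of coefficients [b], and [b'] is the sequence of the derivative. The proof splits the
    factor [k.+1] as [(k.+1 - j) + j]. *)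
Lemma conv_exp_rec t (b b' : nat -> R) (k : nat) :
  (forall j, j.+1%:R * b j.+1 = b' j) ->
  k.+1%:R * (\sum_(0 <= j < k.+2) t ^+ (k.+1 - j) / (k.+1 - j)`!%:R * b j) =
  t * (\sum_(0 <= j < k.+1) t ^+ (k - j) / (k - j)`!%:R * b j) +
  \sum_(0 <= j < k.+1) t ^+ (k - j) / (k - j)`!%:R * b' j.
Proof.
move=> bb'; rewrite mulr_sumr.
rewrite (eq_big_nat _ _ (F2 := fun j =>
  (k.+1 - j)%:R * (t ^+ (k.+1 - j) / (k.+1 - j)`!%:R) * b j +
  t ^+ (k.+1 - j) / (k.+1 - j)`!%:R * (j%:R * b j))); last first.
  move=> j /andP[_ jk]; rewrite natrB //; ring.
rewrite big_split /=; congr (_ + _).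
  rewrite big_nat_recr //= subnn !mul0r addr0 mulr_sumr; apply: eq_big_nat => j /andP[_ jk].
  by rewrite subSn // exp_coeffS [RHS]mulrA.
rewrite big_nat_recl //= mul0r mulr0 add0r; apply: eq_bigr => j _.
by rewrite subSS bb'.
Qed.

Lemma conv_exp_double t (k : nat) :
  \sum_(0 <= j < k.+1) t ^+ (k - j) / (k - j)`!%:R * (t ^+ j / j`!%:R) =
  (2 * t) ^+ k / k`!%:R.
Proof.
elim: k => [|k IHk]; first by rewrite big_nat1 !expr0 fact0 divr1 mulr1.
have k0 : k.+1%:R != 0 :> R by rewrite pnatr_eq0.
apply: (mulfI k0); rewrite exp_coeffS -IHk.
rewrite (@conv_exp_rec t _ (fun j => t * (t ^+ j / j`!%:R))); last exact: exp_coeffS.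
rewrite -mulrA mulr_natl mulr2n; congr (_ + _).
by rewrite mulr_sumr; apply: eq_bigr => j _; rewrite mulrCA.
Qed.

Lemma triangular_sum F n :
  \sum_(0 <= k < n) \sum_(0 <= j < k.+1) F (k - j)%N j =
  \sum_(0 <= j < n) \sum_(0 <= i < n - j) F i j.
Proof.
elim: n => [|n IHn]; first by rewrite !big_geq.
rewrite big_nat_recr //= IHn [RHS]big_nat_recr //= subSnn big_nat1.
rewrite [X in _ + X]big_nat_recr //= subnn addrA -big_split /=; congr (_ + _).
apply: eq_big_nat => j /andP[_ jn].
by rewrite subSn ?(ltnW jn) // big_nat_recr.
Qed.

(** Square minus triangle consists of the terms with [n - j <= i < n], so domination passes to the
    difference term by term. *)
Lemma triangular_sum_dist F G n : (forall i j, `|F i j| <= G i j) ->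
  `|\sum_(0 <= j < n) \sum_(0 <= i < n) F i j - \sum_(0 <= j < n) \sum_(0 <= i < n - j) F i j|
  <= \sum_(0 <= j < n) \sum_(0 <= i < n) G i j - \sum_(0 <= j < n) \sum_(0 <= i < n - j) G i j.
Proof.
move=> FG; rewrite -!sumrB; apply: le_trans (ler_norm_sum _ _ _) _.
apply: ler_sum => j _.
have split_sum (H : nat -> R) : \sum_(0 <= i < n) H i - \sum_(0 <= i < n - j) H i =
    \sum_(n - j <= i < n) H i.
  by rewrite (@big_cat_nat _ _ _ (n - j)) //= ?leq_subr // addrAC subrr add0r.
rewrite !split_sum; apply: le_trans (ler_norm_sum _ _ _) _.
exact: ler_sum.
Qed.

(* The error of the Cauchy product is dominated by that of exp t * exp t = exp (2 t). *)
Lemma cauchy_product_exp t (p : nat -> R) B : 0 <= t -> (forall j, `|p j| <= 1) ->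
  (fun n => \sum_(0 <= j < n) t ^+ j / j`!%:R * p j) @ \oo --> B ->
  (fun n => \sum_(0 <= k < n) \sum_(0 <= j < k.+1)
     (- t) ^+ (k - j) / (k - j)`!%:R * (t ^+ j / j`!%:R * p j)) @ \oo --> expR (- t) * B.
Proof.
move=> t0 p1 hB.
pose e n : R := \sum_(0 <= k < n) t ^+ k / k`!%:R.
pose e2 n : R := \sum_(0 <= k < n) (2 * t) ^+ k / k`!%:R.
pose a n : R := \sum_(0 <= k < n) (- t) ^+ k / k`!%:R.
pose b n : R := \sum_(0 <= j < n) t ^+ j / j`!%:R * p j.
set d := (X in X @ \oo --> _).
have hd n : `|d n - a n * b n| <= e n * e n - e2 n.
  pose F i j := (- t) ^+ i / i`!%:R * (t ^+ j / j`!%:R * p j).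
  pose G i j := t ^+ i / i`!%:R * (t ^+ j / j`!%:R).
  have FG i j : `|F i j| <= G i j.
    rewrite /F /G !normrM !normrX normrN (ger0_norm t0) !normfV !normr_nat.
    apply: ler_wpM2l; first by rewrite divr_ge0 ?exprn_ge0.
    by rewrite ler_piMr // divr_ge0 ?exprn_ge0.
  have prodE (u v : nat -> R) : (\sum_(0 <= i < n) u i) * (\sum_(0 <= j < n) v j) =
     \sum_(0 <= j < n) \sum_(0 <= i < n) u i * v j.
    by rewrite mulr_sumr; apply: eq_bigr => j _; rewrite mulr_suml.
  (* The partial sums of a Cauchy product run over a triangle, the products of partial sums over the
     full square. *)
  have := triangular_sum_dist n FG.
  rewrite -!triangular_sum /a /b /e !prodE distrC.
  by rewrite {2}/G (eq_bigr _ (fun k _ => conv_exp_double t k)).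
have he : e n * e n - e2 n @[n --> \oo] --> (0 : R).
  have -> : 0 = expR t * expR t - expR (2 * t).
    by rewrite -expRD mulr2n mulrDl mul1r subrr.
  by apply: cvgB; [apply: cvgM|]; exact: expR_cvg.
have hab : a n * b n @[n --> \oo] --> expR (- t) * B.
  by apply: cvgM => //; exact: expR_cvg.
have -> : d = (fun n => (d n - a n * b n) + a n * b n).
  by apply/funext => n; rewrite subrK.
rewrite -[_ * B]add0r; apply: cvgD => //.
apply: norm_cvg0; apply: (@squeeze_cvgr _ _ _ _ (fun=> 0) (fun n => e n * e n - e2 n)) => //.
  by near=> n; rewrite normr_ge0 hd.
exact: cvg_cst.
Unshelve. all: by end_near. Qed.

Lemma exp_series_cvg t (p : nat -> R) : 0 <= t -> (forall j, `|p j| <= 1) ->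
  cvgn (fun n => \sum_(0 <= j < n) t ^+ j / j`!%:R * p j).
Proof.
move=> t0 p1; apply: normed_cvg.
apply: (@series_le_cvg _ _ (fun k => t ^+ k / k`!%:R)) => [k|k|k|].
- exact: normr_ge0.
- by rewrite divr_ge0 ?exprn_ge0.
- by rewrite /= normrM ger0_norm ?divr_ge0 ?exprn_ge0 // ler_piMr // divr_ge0 ?exprn_ge0.
- by apply/cvg_ex; exists (expR t); exact: expR_cvg.
Qed.

(** The mean of [r ^+ j] under the Poisson law of parameter [t] is [expR (- (t * (1 - r)))]. Finite
    lists [s] prepare for total variation as a supremum of finite sums; [r = 1] transfers bounds
    that do not decay. *)
Lemma poisson_average_dist (T : Type) (s : seq T) t (p : T -> nat -> R) (B L : T -> R) c r :
  0 <= t ->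
  (forall y, (fun n => \sum_(0 <= j < n) t ^+ j / j`!%:R * p y j) @ \oo --> B y) ->
  (forall j, \sum_(y <- s) `|p y j - L y| <= c * r ^+ j) ->
  \sum_(y <- s) `|expR (- t) * B y - L y| <= c * expR (- (t * (1 - r))).
Proof.
move=> t0 hB H.
pose e n : R := \sum_(0 <= k < n) t ^+ k / k`!%:R.
(* Multiplying through by [expR t] allows comparison with unnormalized partial sums, where the
   inequality holds for every [n]. *)
have bound : \sum_(y <- s) `|B y - L y * expR t| <= c * expR (t * r).
  apply: (@cvgn_le _ (fun n => \sum_(y <- s)
      `|\sum_(0 <= j < n) t ^+ j / j`!%:R * p y j - L y * e n|)
      (fun n => c * \sum_(0 <= k < n) (t * r) ^+ k / k`!%:R)).
  - apply: cvgn_sum => y; apply: cvg_norm; apply: cvgB => //.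
    by apply: cvgMr; exact: expR_cvg.
  - by apply: cvgMr; exact: expR_cvg.
  near=> n.
  apply: (@le_trans _ _ (\sum_(y <- s) \sum_(0 <= j < n) t ^+ j / j`!%:R * `|p y j - L y|)).
    apply: ler_sum => y _; rewrite /e mulr_sumr -sumrB.
    apply: le_trans (ler_norm_sum _ _ _) _; apply: ler_sum => j _.
    rewrite [L y * _]mulrC -mulrBr normrM ger0_norm // divr_ge0 ?exprn_ge0 //.
  rewrite exchange_big /= mulr_sumr; apply: ler_sum => j _.
  rewrite -mulr_sumr exprMn [X in _ <= X](_ : _ = t ^+ j / j`!%:R * (c * r ^+ j)); last first.
    by rewrite mulrACA mulrC -!mulrA; congr (_ * _); rewrite mulrCA mulrC -!mulrA mulrCA.
  by apply: ler_wpM2l => //; rewrite divr_ge0 ?exprn_ge0.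
have -> : c * expR (- (t * (1 - r))) = expR (- t) * (c * expR (t * r)).
  by rewrite mulrCA -expRD; congr (_ * expR _); ring.
have -> : \sum_(y <- s) `|expR (- t) * B y - L y| =
    expR (- t) * \sum_(y <- s) `|B y - L y * expR t|.
  rewrite mulr_sumr; apply: eq_bigr => y _.
  rewrite -[X in X * `|_|](ger0_norm (expR_ge0 _)) -normrM; congr `|_|.
  by rewrite mulrBr mulrCA -expRD addNr expR0 mulr1.
by rewrite ler_pM2l ?expR_gt0.
Unshelve. all: by end_near. Qed.

End ExponentialSeries.

Section Uniformization.
Variables (R : realType) (S : Type) (P Q : (S -> R) -> S -> R) (q : R).
Hypotheses (mP : markov_op P) (QE : forall f x, Q f x = q * (P f x - f x)).

(** Since [Q = q (P - 1)], this is the coefficient form of [exp (t Q) = exp (- t q) exp (t q P)].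
    Both sides satisfy the same recursion in [k], the right one by [conv_exp_rec]. *)
Lemma uniformization_term (t : R) f (k : nat) x :
  t ^+ k / k`!%:R * iter k Q f x =
  \sum_(0 <= j < k.+1) (- (t * q)) ^+ (k - j) / (k - j)`!%:R *
    ((t * q) ^+ j / j`!%:R * iter j P f x).
Proof.
elim: k x => [|k IHk] x; first by rewrite big_nat1 !expr0 fact0 divr1 !mul1r.
have k0 : k.+1%:R != 0 :> R by rewrite pnatr_eq0.
apply: (mulfI k0).
rewrite (@conv_exp_rec _ _ _ (fun j => t * q * ((t * q) ^+ j / j`!%:R * iter j.+1 P f x))); last first.
  by move=> j; rewrite [LHS]mulrA exp_coeffS -[LHS]mulrA.
rewrite -IHk [LHS]mulrA exp_coeffS iterS QE.
have -> : \sum_(0 <= j < k.+1) (- (t * q)) ^+ (k - j) / (k - j)`!%:R *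
     (t * q * ((t * q) ^+ j / j`!%:R * iter j.+1 P f x)) =
   t * q * P (fun y => t ^+ k / k`!%:R * iter k Q f y) x.
  have -> : (fun y => t ^+ k / k`!%:R * iter k Q f y) = (fun y =>
      \sum_(0 <= j < k.+1) ((- (t * q)) ^+ (k - j) / (k - j)`!%:R * ((t * q) ^+ j / j`!%:R)) *
        iter j P f y).
    by apply/funext => y; rewrite IHk; apply: eq_bigr => j _; rewrite mulrA.
  rewrite mop_sum // mulr_sumr; apply: eq_bigr => j _ /=; ring.
rewrite mopZ //; ring.
Qed.

Lemma uniformization_cvg (t : R) f x : 0 <= t * q -> (forall x, `|f x| <= 1) ->
  exists B, (fun n => \sum_(0 <= j < n) (t * q) ^+ j / j`!%:R * iter j P f x) @ \oo --> B /\
   limn (fun n => \sum_(0 <= k < n) (t ^+ k / k`!%:R * iter k Q f x)) = expR (- (t * q)) * B.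
Proof.
move=> t0 f1.
have p1 j : `|iter j P f x| <= 1.
  have mPj := markov_iter mP j.
  by have := mop_norm mPj f1 x; rewrite (mop_cst mPj).
have [B hB] := (cvg_ex _).1 (exp_series_cvg t0 p1).
exists B; split=> //; apply: cvg_lim => //.
have := cauchy_product_exp t0 p1 hB.
rewrite (_ : (fun n => _) = (fun n => \sum_(0 <= k < n) (t ^+ k / k`!%:R * iter k Q f x))) //.
by apply/funext => n; apply: eq_bigr => k _; rewrite uniformization_term.
Qed.

End Uniformization.

(** * Exponential ergodicity *)

Section RealEsum.
Variables (R : realType) (S : choiceType).
Implicit Types (u : S -> R) (c : R) (s : seq S).

Lemma esum_le_real u c : (forall s, uniq s -> \sum_(x <- s) u x <= c) ->
  (\esum_(x in [set: S]) (u x)%:E <= c%:E)%E.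
Proof.
move=> H; apply: ge_ereal_sup => _ [A [fA _] <-].
by rewrite fsbig_finite //= sumEFin lee_fin; apply: H; exact: finmap.fset_uniq.
Qed.

Lemma esum_ge_real u s : uniq s ->
  ((\sum_(x <- s) u x)%:E <= \esum_(x in [set: S]) (u x)%:E)%E.
Proof.
move=> us; apply: ereal_sup_ubound; exists [set` s].
  by split => //; exact: finite_seq.
by rewrite -fsbig_seq // sumEFin.
Qed.

Lemma esum_eq_real u c : (forall s, uniq s -> \sum_(x <- s) u x <= c) ->
  (forall e, 0 < e -> exists2 s, uniq s & c <= \sum_(x <- s) u x + e) ->
  (\esum_(x in [set: S]) (u x)%:E = c%:E)%E.
Proof.
move=> H1 H2; apply/eqP; rewrite eq_le esum_le_real //=.
apply/lee_addgt0Pr => e e0; have [s us hs] := H2 _ e0.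
apply: (@le_trans _ _ ((\sum_(x <- s) u x)%:E + e%:E)%E); first by rewrite -EFinD lee_fin.
by rewrite leeD2r // esum_ge_real.
Qed.

(** The prescribed point [y] lets the term at [y] be isolated when two laws are compared. Adjoining
    it to a list only increases the sum, as [u] is nonnegative. *)
Lemma esum_approx u c y e : (forall x, 0 <= u x) ->
  (\esum_(x in [set: S]) (u x)%:E = c%:E)%E -> 0 < e ->
  exists s, [/\ uniq s, y \in s & c - e < \sum_(x <- s) u x].
Proof.
move=> u0 uc e0; apply: contrapT => H.
suff : (\esum_(x in [set: S]) (u x)%:E <= (c - e)%:E)%E.
  by rewrite uc lee_fin; lra.
apply: esum_le_real => s us; rewrite leNgt; apply/negP => hs; apply: H.
have [ys|ys] := boolP (y \in s); first by exists s.
exists (y :: s); split; rewrite /= ?ys ?mem_head // big_cons.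
by have := u0 y; lra.
Qed.

(** Applying an operator to [ind y] and evaluating at [x] reads off its kernel entry from [x] to
    [y]. *)
Definition ind (y : S) : S -> R := fun w => (w == y)%:R.

Lemma sum_ind u s x : uniq s -> \sum_(y <- s) u y * ind y x = u x * (x \in s)%:R.
Proof.
elim: s => [|y s IHs] /=; first by rewrite big_nil mulr0.
move=> /andP[ys us]; rewrite big_cons IHs // in_cons /ind.
have [->|xy] := eqVneq x y; first by rewrite (negbTE ys) mulr0 addr0.
by rewrite mulr0 add0r.
Qed.

End RealEsum.

Lemma expR_decay (R : realType) (c a e : R) : 0 <= c -> 0 < a -> 0 < e ->
  exists2 T, 0 <= T & forall t, T <= t -> c * expR (- (a * t)) < e.
Proof.
move=> c0 a0 e0; exists (c / e / a) => [|t]; first by rewrite !divr_ge0 // ltW.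
rewrite ler_pdivrMr // ler_pdivrMr // => h.
rewrite expRN ltr_pdivrMr ?expR_gt0 //.
apply: (@lt_le_trans _ _ (e * (1 + a * t))); first by lra.
by rewrite ler_pM2l // expR_ge1Dx.
Qed.

Section Ergodic.
Variables (R : realType) (S : choiceType) (P Q : (S -> R) -> S -> R).
Variables (V : S -> R) (q g K : R) (o : S).
Hypotheses (mP : markov_op P) (QE : forall f x, Q f x = q * (P f x - f x)) (q0 : 0 < q)
  (V0 : forall x, 0 <= V x) (g0 : 0 <= g) (g1 : g < 1) (K0 : 0 <= K)
  (PV : forall x, P V x <= g * V x + K).
Hypothesis minor : forall L, exists m0, forall m, (m0 <= m)%N -> exists2 d : R, 0 < d &
  forall x (f : S -> R), V x <= L -> (forall u, 0 <= f u) -> d * f o <= iter m P f x.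
Hypothesis sublevel : forall L, exists s : seq S, forall x, V x <= L -> x \in s.

Definition semigroup (t : R) (x y : S) : R :=
  limn (fun n => \sum_(0 <= k < n) (t ^+ k / k`!%:R * iter k Q (ind R y) x)).

Definition stationary (pi : S -> R) : Prop :=
  (forall x, 0 <= pi x) /\
  (\esum_(x in [set: S]) (pi x)%:E = 1%E) /\
  (forall t, 0 <= t -> forall y,
     \esum_(x in [set: S]) (pi x * semigroup t x y)%:E = (pi y)%:E).

(** By [iter_lyapunov0], [M] bounds the mean of [V] under every law [P^k(o, -)]; [W x] is the
    resulting weight when a start at [x] is compared with a late start from [o]. *)
Let M := V o + K / (1 - g).
Let W x := 1 + V x + M.

Lemma M_ge0 : 0 <= M.
Proof. by rewrite addr_ge0 // divr_ge0 // subr_ge0 ltW. Qed.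

Lemma ind_ge0 (y x : S) : 0 <= ind R y x. Proof. exact: ler0n. Qed.

Lemma ind_le1 (y x : S) : ind R y x <= 1. Proof. by rewrite lern1 leq_b1. Qed.

Lemma ind_norm (y x : S) : `|ind R y x| <= 1.
Proof. by rewrite ger0_norm ?ind_ge0 // ind_le1. Qed.

(** The limit law is the limit of [P^k(o, -)]. The value [P^(k+l) phi (o)] averages [P^k phi] over
    [P^l(o, -)], whose [V]-mean is at most [M], so the oscillation bound gives a Cauchy estimate
    uniform in [l]. *)
Lemma discrete_ergodic : exists r C (pi : S -> R), [/\ 0 < r, r < 1, 0 <= C &
  forall s k x, uniq s -> \sum_(y <- s) `|iter k P (ind R y) x - pi y| <= C * W x * r ^+ k].
Proof.
have [r [C [r0 r1 C0 H]]] := geometric_contraction mP V0 g0 g1 K0 PV minor.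
have D phi : (forall x, `|phi x| <= 1) -> forall k l x,
    `|iter k P phi x - iter (k + l) P phi o| <= C * W x * r ^+ k.
  move=> phi1 k l x; have mPl := markov_iter mP l.
  rewrite addnC iterD distrC.
  have -> : iter l P (iter k P phi) o - iter k P phi x =
      iter l P (fun u => iter k P phi u - iter k P phi x) o.
    by rewrite (mopB mPl) (mop_cst mPl).
  have hn u : `|iter k P phi u - iter k P phi x| <=
      C * r ^+ k * (1 + V x) + C * r ^+ k * V u.
    by apply: le_trans (H _ phi1 k u x) _; lra.
  apply: le_trans (mop_norm mPl hn o) _; rewrite (mop_aff mPl).
  have z0 : 0 <= C * r ^+ k by rewrite mulr_ge0 // exprn_ge0 // ltW.
  have := ler_wpM2l z0 (iter_lyapunov0 mP V0 g0 g1 K0 PV l o).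
  rewrite /W /M; lra.
exists r, C, (fun y => limn (fun k => iter k P (ind R y) o)).
split => // s k x us.
have cv y : iter n P (ind R y) o @[n --> \oo] --> limn (fun k => iter k P (ind R y) o).
  apply: (@geometric_cauchy_cvg _ (fun k => iter k P (ind R y) o) (C * W o) r) => //.
    exact: ltW.
  by move=> j l; rewrite distrC; apply: D; exact: ind_norm.
apply: (@cvgn_le _ (fun l => \sum_(y <- s) `|iter k P (ind R y) x - iter (k + l) P (ind R y) o|)
   (fun=> C * W x * r ^+ k)).
- apply: cvgn_sum => y; apply: cvg_norm; apply: cvgB; first exact: cvg_cst.
  under eq_fun do rewrite addnC.
  by have := cv y; rewrite -(cvg_shiftn k (fun n => iter n P (ind R y) o)).
- exact: cvg_cst.
near=> l.
(* The sign pattern on [s] is a test function bounded by 1 that turns the sum of absolute values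
   into a single difference. *)
pose c y := Num.sg (iter k P (ind R y) x - iter (k + l) P (ind R y) o).
pose phi u := \sum_(y <- s) c y * ind R y u.
have phi1 u : `|phi u| <= 1.
  rewrite /phi sum_ind // normrM normr_nat normr_sg.
  by rewrite -natrM lern1 mulnb leq_b1.
have := D _ phi1 k l x; apply: le_trans; apply: le_trans (ler_norm _).
rewrite /phi (mop_sum (markov_iter mP k)) (mop_sum (markov_iter mP (k + l))) -sumrB.
by apply: ler_sum => y _; rewrite normrEsg mulrBr.
Unshelve. all: by end_near. Qed.

Section Limit.
Variables (r C : R) (pi : S -> R).
Hypotheses (r0 : 0 < r) (r1 : r < 1) (C0 : 0 <= C)
  (TV : forall s k x, uniq s ->
     \sum_(y <- s) `|iter k P (ind R y) x - pi y| <= C * W x * r ^+ k).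

Lemma W_ge0 x : 0 <= W x.
Proof. by rewrite /W; have := M_ge0; have := V0 x; lra. Qed.

Lemma iter_dist k x y : `|iter k P (ind R y) x - pi y| <= C * W x * r ^+ k.
Proof. by have := @TV [:: y] k x isT; rewrite big_seq1. Qed.

Lemma iter_ind_cvg y : iter k P (ind R y) o @[k --> \oo] --> pi y.
Proof.
apply/cvgrPdist_lt => e e0.
have [N hN] := geometric_lt (C * W o) (ltW r0) r1 e0.
exists N => // k /= Nk; rewrite distrC; apply: le_lt_trans (iter_dist _ _ _) _.
apply: le_lt_trans hN; apply: ler_wpM2l; first by rewrite mulr_ge0 // W_ge0.
by apply: ler_wiXn2l => //; exact: ltW.
Qed.

Lemma iter_ind_ge0 k y x : 0 <= iter k P (ind R y) x.
Proof. by apply: (mop_ge0 (markov_iter mP k)) => u; exact: ind_ge0. Qed.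

Lemma iter_ind_le1 k y x : iter k P (ind R y) x <= 1.
Proof.
have mPk := markov_iter mP k; rewrite -[leRHS](mop_cst mPk 1 x).
by apply: (mop_le mPk) => u; exact: ind_le1.
Qed.

Lemma pi_ge0 y : 0 <= pi y.
Proof.
apply: (@cvgn_le _ (fun=> 0) (fun k => iter k P (ind R y) o)).
- exact: cvg_cst.
- exact: iter_ind_cvg.
by near=> k; exact: iter_ind_ge0.
Unshelve. all: by end_near. Qed.

Lemma pi_le1 y : pi y <= 1.
Proof.
apply: (@cvgn_le _ (fun k => iter k P (ind R y) o) (fun=> 1)).
- exact: iter_ind_cvg.
- exact: cvg_cst.
by near=> k; exact: iter_ind_le1.
Unshelve. all: by end_near. Qed.

(* The laws P^k(o, -) are tight because they integrate V boundedly. *)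
Lemma esum_pi (h : S -> R) l : (forall x, 0 <= h x) -> (forall x, h x <= 1) ->
  iter k P h o @[k --> \oo] --> l -> (\esum_(x in [set: S]) (pi x * h x)%:E = l%:E)%E.
Proof.
move=> h0 h1 hl.
have cv s : \sum_(x <- s) h x * iter k P (ind R x) o @[k --> \oo] --> \sum_(x <- s) pi x * h x.
  apply: (@cvgn_sum _ _ _ (fun x k => h x * iter k P (ind R x) o)) => x.
  by rewrite mulrC; apply: cvgMr; exact: iter_ind_cvg.
apply: esum_eq_real => [s us|e e0].
  apply: (cvgn_le (cv s) hl); near=> k; have mPk := markov_iter mP k.
  rewrite -(mop_sum mPk); apply: (mop_le mPk) => x; rewrite sum_ind //.
  by rewrite ler_piMr // lern1 leq_b1.
have M0 := M_ge0.
(* Markov's inequality leaves mass at most [M / L <= e] outside the sublevel set; the 1 keeps [L]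
   positive when [M = 0]. *)
pose L := (M + 1) / e.
have L0 : 0 < L by rewrite divr_gt0 //; lra.
have [s hs] := sublevel L.
exists (undup s); first exact: undup_uniq.
have ML : M / L <= e.
  rewrite /L invf_div mulrA ler_pdivrMr; last by lra.
  by rewrite [M * e]mulrC ler_pM2l //; lra.
apply: le_trans (_ : _ <= \sum_(x <- undup s) pi x * h x + M / L) _; last by rewrite lerD2l.
apply: (cvgn_le hl (cvgD (cv (undup s)) (cvg_cst (M / L)))).
near=> k; have mPk := markov_iter mP k.
(* Off the list [V x > L], so [h x <= 1 <= V x / L]. *)
apply: (@le_trans _ _ (iter k P (fun x => (\sum_(y <- undup s) h y * ind R y x) + L^-1 * V x) o)).
  apply: (mop_le mPk) => x; rewrite sum_ind ?undup_uniq // mem_undup.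
  have Li : 0 <= L^-1 * V x by rewrite mulr_ge0 // invr_ge0 ltW.
  have [xs|xs] := boolP (x \in s); first by rewrite mulr1 lerDl.
  rewrite mulr0 add0r mulrC ler_pdivlMr //.
  have : ~~ (V x <= L) by apply: contra xs => /hs.
  rewrite -ltNge => /ltW; apply: le_trans.
  by rewrite ler_piMl // ltW.
rewrite (mopD mPk) (mop_sum mPk) (mopZ mPk) lerD2l mulrC ler_pM2r ?invr_gt0 //.
exact: iter_lyapunov0.
Unshelve. all: by end_near. Qed.

Lemma esum_pi1 : (\esum_(x in [set: S]) (pi x)%:E = 1%:E)%E.
Proof.
rewrite -(@esum_pi (fun=> 1) 1) //; last first.
  under eq_fun do rewrite (mop_cst (markov_iter mP _)); exact: cvg_cst.
by apply: eq_esum => x _; rewrite mulr1.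
Qed.

Section Time.
Variable t : R.
Hypothesis t0 : 0 <= t.

Let tq0 : 0 <= t * q. Proof. by rewrite mulr_ge0 // ltW. Qed.

Lemma semigroup_cvg x y :
  (fun n => \sum_(0 <= j < n) (t * q) ^+ j / j`!%:R * iter j P (ind R y) x) @ \oo -->
  expR (t * q) * semigroup t x y.
Proof.
rewrite /semigroup; have [B [hB ->]] := @uniformization_cvg _ _ P Q q mP QE t (ind R y) x tq0 (ind_norm y).
by rewrite mulrA -expRD subrr expR0 mul1r.
Qed.

Lemma semigroup_dist s x : uniq s -> \sum_(y <- s) `|semigroup t x y - pi y| <=
  C * W x * expR (- (t * q * (1 - r))).
Proof.
move=> us.
have := @poisson_average_dist _ _ s (t * q) (fun y j => iter j P (ind R y) x)
  (fun y => expR (t * q) * semigroup t x y) pi (C * W x) r tq0 (@semigroup_cvg x)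
  (fun j => @TV s j x us).
by under eq_bigr do rewrite mulrA -expRD addNr expR0 mul1r.
Qed.

(** Lying in [[0, 1]] is being within 1/2 of 1/2, a form that [poisson_average_dist] carries over
    with [r = 1]. *)
Lemma semigroup_norm x y : `|semigroup t x y - 2^-1| <= 2^-1.
Proof.
have := @poisson_average_dist _ S [:: y] (t * q) (fun y j => iter j P (ind R y) x)
  (fun y => expR (t * q) * semigroup t x y) (fun=> 2^-1) 2^-1 1 tq0 (@semigroup_cvg x).
rewrite subrr mulr0 oppr0 expR0 mulr1 big_seq1 mulrA -expRD addNr expR0 mul1r; apply=> j.
rewrite big_seq1 expr1n mulr1 ler_norml.
have := iter_ind_ge0 j y x; have := iter_ind_le1 j y x; lra.
Qed.

Lemma semigroup_ge0 x y : 0 <= semigroup t x y.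
Proof. by have := semigroup_norm x y; rewrite ler_norml; lra. Qed.

Lemma semigroup_le1 x y : semigroup t x y <= 1.
Proof. by have := semigroup_norm x y; rewrite ler_norml; lra. Qed.

(** Continuity moves [P^k] inside the Poisson average, leaving the average over [j] of
    [P^(k+j)(o, y)], each within [C * W o * r ^+ k] of [pi y]. With [esum_pi] this yields invariance
    of [pi]. *)
Lemma iter_semigroup_dist k y :
  `|iter k P (semigroup t ^~ y) o - pi y| <= C * W o * r ^+ k.
Proof.
have mPk := markov_iter mP k.
have cv : (fun n => \sum_(0 <= j < n) (t * q) ^+ j / j`!%:R * iter (k + j) P (ind R y) o) @ \oo
    --> expR (t * q) * iter k P (semigroup t ^~ y) o.
  have : iter k P (fun x => \sum_(0 <= j < n) (t * q) ^+ j / j`!%:R * iter j P (ind R y) x) o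
      @[n --> \oo] --> iter k P (fun x => expR (t * q) * semigroup t x y) o.
    by apply: (mop_cvg mPk) => x; exact: semigroup_cvg.
  rewrite (mopZ mPk).
  under eq_fun do rewrite (mop_sum mPk).
  under eq_fun do under eq_bigr do rewrite -iterD.
  exact.
have := @poisson_average_dist _ S [:: y] (t * q) (fun _ j => iter (k + j) P (ind R y) o)
  (fun _ => expR (t * q) * iter k P (semigroup t ^~ y) o) pi (C * W o * r ^+ k) 1 tq0 (fun=> cv).
rewrite subrr mulr0 oppr0 expR0 mulr1 big_seq1 mulrA -expRD addNr expR0 mul1r; apply=> j.
rewrite big_seq1 expr1n mulr1; apply: le_trans (iter_dist _ _ _) _.
apply: ler_wpM2l; first by rewrite mulr_ge0 // W_ge0.
by rewrite exprD ler_piMr ?exprn_ge0 ?exprn_ile1 // ltW.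
Qed.

Lemma pi_invariant y : (\esum_(x in [set: S]) (pi x * semigroup t x y)%:E = (pi y)%:E)%E.
Proof.
apply: (@esum_pi (semigroup t ^~ y)) => [x|x|].
- exact: semigroup_ge0.
- exact: semigroup_le1.
apply/cvgrPdist_lt => e e0.
have [N hN] := geometric_lt (C * W o) (ltW r0) r1 e0.
exists N => // k /= Nk; rewrite distrC; apply: le_lt_trans (iter_semigroup_dist _ _) _.
apply: le_lt_trans hN; apply: ler_wpM2l; first by rewrite mulr_ge0 // W_ge0.
by apply: ler_wiXn2l => //; exact: ltW.
Qed.

End Time.

(** A finite list carries almost all the mass of [pi'], and from its points the semigroup at a late
    time is uniformly close to [pi]. Invariance of [pi'] then gives [pi <= pi'] pointwise, which
    forces equality of two probability laws. *)
Lemma stationary_unique pi' : stationary pi' -> pi' = pi.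
Proof.
move=> [p0 [p1 pinv]].
have le_pi y : pi y <= pi' y.
  (* One half of [e'] covers the mass of [pi'] off the list, the other the distance to equilibrium
     at time [T]. *)
  apply/ler_addgt0Pr => e' e'0; pose e := e' / 2.
  have e0 : 0 < e by rewrite divr_gt0.
  have [s [us _ hs]] := esum_approx y p0 p1 e0.
  have c0 : 0 <= \sum_(x <- s) C * W x by rewrite sumr_ge0 // => x _; rewrite mulr_ge0 // W_ge0.
  have a0 : 0 < q * (1 - r) by rewrite mulr_gt0 // subr_gt0.
  have [T T0 /(_ T (lexx T)) hT] := expR_decay c0 a0 e0.
  have p'1 x : pi' x <= 1.
    by have := esum_ge_real pi' (isT : uniq [:: x]); rewrite p1 big_seq1 lee_fin.
  have E1 : \sum_(x <- s) pi' x * semigroup T x y <= pi' y.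
    by rewrite -lee_fin -(pinv _ T0 y); exact: (esum_ge_real (fun x => pi' x * semigroup T x y)).
  have E2 : \sum_(x <- s) (pi' x * pi y - C * W x * expR (- (q * (1 - r) * T))) <=
      \sum_(x <- s) pi' x * semigroup T x y.
    apply: ler_sum => x _; rewrite lerBlDr -lerBlDl -mulrBr.
    have := @semigroup_dist T T0 [:: y] x isT; rewrite big_seq1 => h.
    rewrite [q * _ * T]mulrC mulrA; apply: le_trans h.
    apply: (@le_trans _ _ (1 * `|pi y - semigroup T x y|)); last by rewrite mul1r distrC.
    apply: (@le_trans _ _ (pi' x * `|pi y - semigroup T x y|)).
      by apply: ler_wpM2l => //; exact: ler_norm.
    exact: ler_wpM2r.
  have E3 : (1 - e) * pi y <= (\sum_(x <- s) pi' x) * pi y.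
    by apply: ler_wpM2r; [exact: pi_ge0|exact: ltW].
  have E4 : e * pi y <= e by rewrite ler_piMr ?pi_le1 // ltW.
  move: E2; rewrite sumrB -mulr_suml -mulr_suml => E2.
  have -> : e' = e + e by rewrite /e; lra.
  lra.
apply/funext => y; apply/eqP; rewrite eq_le le_pi andbT leNgt; apply/negP => lt_pi.
have e0 : 0 < pi' y - pi y by rewrite subr_gt0.
have [s [us ys hs]] := esum_approx y pi_ge0 esum_pi1 e0.
have : \sum_(x <- s) pi' x <= 1 by rewrite -lee_fin -p1; exact: esum_ge_real.
have : pi' y - pi y <= \sum_(x <- s) (pi' x - pi x).
  rewrite (bigD1_seq y) //= lerDl sumr_ge0 // => x _.
  by rewrite subr_ge0.
rewrite sumrB; lra.
Qed.

(** Half of the decay rate [q * (1 - r)] goes into the exponential weight; the other half still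
    drives the product to 0. *)
Lemma semigroup_exponential x :
  ((expR (q * (1 - r) / 2 * t))%:E *
     \esum_(y in [set: S]) (`|semigroup t x y - pi y|)%:E)%E @[t --> +oo] --> 0%E.
Proof.
have a0 : 0 < q * (1 - r) / 2 by rewrite divr_gt0 // mulr_gt0 // subr_gt0.
have CW0 : 0 <= C * W x by rewrite mulr_ge0 // W_ge0.
apply: (@squeeze_cvge _ _ _ _ (fun=> 0%E) _
  (fun t => (C * W x * expR (- (q * (1 - r) / 2 * t)))%:E)); last 2 first.
- exact: cvg_cst.
- apply: cvg_EFin; first by apply: nearW.
  apply/cvgrPdist_lt => e e0; have [T _ hT] := expR_decay CW0 a0 e0.
  near=> t; rewrite sub0r normrN /= ger0_norm; last by apply: mulr_ge0 => //; exact: expR_ge0.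
  by apply: hT; near: t; apply: nbhs_pinfty_ge; exact: num_real.
apply: filterS (nbhs_pinfty_ge (num_real 0)) => t t0.
apply/andP; split.
  by apply: mule_ge0; [rewrite lee_fin expR_ge0|apply: esum_ge0 => y _; rewrite lee_fin].
apply: (@le_trans _ _ ((expR (q * (1 - r) / 2 * t))%:E *
   (C * W x * expR (- (t * q * (1 - r))))%:E)%E).
  apply: lee_wpmul2l; first by rewrite lee_fin expR_ge0.
  by apply: esum_le_real => s us; exact: semigroup_dist.
rewrite -EFinM lee_fin mulrCA -expRD; apply: ler_wpM2l => //.
by rewrite ler_expR; lra.
Unshelve. all: by end_near. Qed.

End Limit.

Theorem exponential_ergodicity : exists pi, stationary pi /\
  (forall pi', stationary pi' -> pi' = pi) /\
  exists kappa : R, 0 < kappa /\ forall x,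
    ((expR (kappa * t))%:E *
       \esum_(y in [set: S]) (`|semigroup t x y - pi y|)%:E)%E @[t --> +oo] --> 0%E.
Proof.
have [r [C [pi [r0 r1 C0 TV]]]] := discrete_ergodic.
exists pi; split; last split.
- split; first exact: (pi_ge0 r0 r1 C0 TV).
  split; first exact: (esum_pi1 r0 r1 C0 TV).
  by move=> t t0 y; exact: (pi_invariant r0 r1 C0 TV).
- by move=> pi'; exact: (stationary_unique r0 r1 C0 TV).
- exists (q * (1 - r) / 2); split; first by rewrite divr_gt0 // mulr_gt0 // subr_gt0.
  by move=> x; exact: (semigroup_exponential r1 C0 TV).
Qed.

End Ergodic.

(** * The queueing network *)

Section Chain.
Variables (R : realType) (I J : nat) (E : 'I_I -> 'I_J -> bool).
Variables (N : 'I_J -> nat) (lam : 'I_I -> R) (mu : 'I_I -> 'I_J -> R) (z : policy I J).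
Hypotheses (lam0 : forall i, 0 <= lam i) (mu0 : forall i j, E i j -> 0 < mu i j)
  (zN : forall x, in_Zn E N x (z x)).

Definition death_rate (x : state I) (i : 'I_I) : R := \sum_(j < J | E i j) mu i j * (z x i j)%:R.

Lemma genE (f : state I -> R) x : gen E lam mu z f x =
  \sum_(i < I) (lam i * (f (e_up x i) - f x) + death_rate x i * (f (e_down x i) - f x)).
Proof. by apply: eq_bigr => i _; rewrite mulr_suml. Qed.

Lemma death_rate_ge0 x i : 0 <= death_rate x i.
Proof. by rewrite sumr_ge0 // => j Eij; rewrite mulr_ge0 // ltW // mu0. Qed.

(** No customer of an empty class is in service, so the truncated predecessor in [e_down] never acts
    with positive rate. *)
Lemma death_rate_eq0 (x : state I) i : x i = 0%N -> death_rate x i = 0.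
Proof.
move=> xi; rewrite /death_rate big1 // => j _.
have [_ [/(_ i) zx _]] := zN x; move: zx; rewrite xi (bigD1 j) //= leqn0 addn_eq0.
by move=> /andP[/eqP -> _]; rewrite mulr0.
Qed.

Lemma death_rate_le x i : death_rate x i <= \sum_(j < J | E i j) mu i j * (N j)%:R.
Proof.
apply: ler_sum => j Eij; rewrite ler_pM2l ?mu0 // ler_nat.
have [_ [_ [/(_ j) zx _]]] := zN x; apply: leq_trans zx.
by rewrite (bigD1 i) //= leq_addr.
Qed.

Section Uniformized.
Variable q : R.
Hypotheses (q0 : 0 < q)
  (qE : 2 * \sum_(i < I) (lam i + \sum_(j < J | E i j) mu i j * (N j)%:R) <= q).

(** Uniformized jump chain; the factor 2 in [qE] makes it stay put with probability at least 1/2. *)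
Definition unif (f : state I -> R) (x : state I) : R := f x + gen E lam mu z f x / q.

Lemma unif_ge (f : state I -> R) x : (forall u, 0 <= f u) ->
  f x / 2 + (\sum_(i < I) (lam i * f (e_up x i) + death_rate x i * f (e_down x i))) / q
    <= unif f x.
Proof.
move=> f0; rewrite /unif genE.
rewrite [X in _ <= _ + X / q](eq_bigr (fun i => (lam i * f (e_up x i) + death_rate x i * f (e_down x i)) -
  (lam i + death_rate x i) * f x)); last by move=> i _; ring.
rewrite sumrB -mulr_suml mulrBl.
have tot : \sum_(i < I) (lam i + death_rate x i) <= q / 2.
  rewrite ler_pdivlMr // mulrC; apply: le_trans qE; rewrite ler_pM2l //.
  by apply: ler_sum => i _; rewrite lerD2l death_rate_le.
have : (\sum_(i < I) (lam i + death_rate x i)) * f x / q <= f x / 2.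
  rewrite ler_pdivrMr //; have := ler_wpM2r (f0 x) tot; lra.
lra.
Qed.

Lemma unif_markov : markov_op unif.
Proof.
split=> [a f h x|f f0 x|c x|u f uf x].
- rewrite /unif !genE mulrDr mulrA [a * _ / q]mulrAC -!mulrA.
  rewrite (eq_bigr (fun i => a * (lam i * (f (e_up x i) - f x) +
     death_rate x i * (f (e_down x i) - f x)) + (lam i * (h (e_up x i) - h x) +
     death_rate x i * (h (e_down x i) - h x)))); last by move=> i _; ring.
  by rewrite big_split /= -mulr_sumr; ring.
- apply: le_trans (unif_ge x f0); rewrite addr_ge0 ?divr_ge0 ?(ltW q0) // sumr_ge0 // => i _.
  by rewrite addr_ge0 // mulr_ge0 // death_rate_ge0.
- by rewrite /unif genE big1 ?mul0r ?addr0 // => i _; rewrite !subrr !mulr0 addr0.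
- apply: cvgD => //; apply: cvgMl; rewrite genE.
  under eq_fun do rewrite genE.
  apply: (@cvgn_sum _ _ _ (fun i n => lam i * (u n (e_up x i) - u n x) +
     death_rate x i * (u n (e_down x i) - u n x))) => i.
  by apply: cvgD; apply: cvgMr; apply: cvgB.
Qed.

Hypotheses (Nnt : forall i, exists2 j, E i j & (0 < N j)%N).

Let o : state I := [ffun=> 0%N].

(** Work conservation: if nobody were served, a nonempty class would queue next to an idle
    compatible server. *)
Lemma death_exists (x : state I) : x != o -> exists i, 0 < death_rate x i /\ (0 < x i)%N.
Proof.
move=> xo; have [i0 xi0] : exists i, (0 < x i)%N.
  apply: contrapT => H; case/negP: xo; apply/eqP/ffunP => i; rewrite ffunE.
  by apply/eqP; rewrite -leqn0 leqNgt; apply/negP => xi; apply: H; exists i.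
have [zE [zx [_ zc]]] := zN x.
suff [i [j zij]] : exists i j, (0 < z x i j)%N.
  have Eij : E i j by case: (boolP (E i j)) => // /zE zij0; rewrite zij0 in zij.
  exists i; split.
    rewrite /death_rate (bigD1 j) //= ltr_pwDl ?mulr_gt0 ?mu0 ?ltr0n //.
    by rewrite sumr_ge0 // => j' /andP[Eij' _]; rewrite mulr_ge0 // ltW // mu0.
  by apply: leq_trans (zx i); rewrite (bigD1 j) //= ltn_addr.
have [j Eij Nj] := Nnt i0.
apply: contrapT => H.
have z0 i' j' : z x i' j' = 0%N.
  by apply/eqP; rewrite -leqn0 leqNgt; apply/negP => zij; apply: H; exists i', j'.
have := zc _ _ Eij; rewrite !big1 // !subn0 => m0.
by have : (0 < minn (x i0) (N j))%N; [rewrite leq_min xi0|rewrite m0].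
Qed.

(** Each step can remove one customer, and laziness lets the chain wait in the empty state, so [m]
    need only bound the total population. *)
Lemma hit_empty m (x : state I) : (\sum_(i < I) x i <= m)%N -> 0 < iter m unif (ind R o) x.
Proof.
elim: m x => [|m IHm] x xm.
  have -> : x = o.
    apply/ffunP => i; rewrite ffunE; apply/eqP; rewrite -leqn0.
    by apply: leq_trans xm; rewrite (bigD1 i) //= leq_addr.
  by rewrite /= /ind eqxx ltr01.
have h0 u : 0 <= iter m unif (ind R o) u.
  by apply: (mop_ge0 (markov_iter unif_markov m)) => v; exact: ler0n.
rewrite iterS; apply: lt_le_trans (unif_ge x h0).
have s0 (A : pred 'I_I) : 0 <= \sum_(i < I | A i)
    (lam i * iter m unif (ind R o) (e_up x i) + death_rate x i * iter m unif (ind R o) (e_down x i)).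
  by rewrite sumr_ge0 // => i _; rewrite addr_ge0 // mulr_ge0 // death_rate_ge0.
have [xo|xo] := eqVneq x o.
  apply: ltr_pwDl; last by apply: divr_ge0; [exact: (s0 predT)|exact: ltW].
  apply: divr_gt0 => //; apply: IHm.
  by rewrite xo big1 // => i _; rewrite ffunE.
have [i [bi xi]] := death_exists xo.
apply: ltr_wpDl; first by apply: divr_ge0.
apply: divr_gt0 => //; rewrite (bigD1 i) //=; apply: ltr_pwDl; last exact: s0.
apply: ltr_wpDl; first by apply: mulr_ge0.
apply: mulr_gt0 => //; apply: IHm.
rewrite -ltnS; apply: leq_trans xm.
rewrite [X in (_ < X)%N](bigD1 i) //= [X in (X < _)%N](bigD1 i) //= ffunE eqxx.
rewrite (eq_bigr (fun k => x k)); last by move=> k /negbTE ki; rewrite ffunE ki.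
by rewrite -addSn prednK.
Qed.

End Uniformized.

Lemma QpowE k y : (Qpow E lam mu z k)^~ y = iter k (gen E lam mu z) (ind R y).
Proof. by elim: k => //= k <-. Qed.

Lemma list_min_gt0 (T : eqType) (s : seq T) (h : T -> R) :
  (forall x, x \in s -> 0 < h x) -> exists2 d, 0 < d & forall x, x \in s -> d <= h x.
Proof.
elim: s => [|x s IHs] H; first by exists 1.
have [|d d0 hd] := IHs; first by move=> y ys; apply: H; rewrite in_cons ys orbT.
exists (Num.min d (h x)); first by rewrite lt_min d0 H ?mem_head.
by move=> y; rewrite in_cons ge_min => /predU1P[->|/hd ->//]; rewrite lexx orbT.
Qed.

Lemma chain_ergodic (V : state I -> R) (c0 c1 : R) :
  (forall i, exists2 j, E i j & (0 < N j)%N) ->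
  0 <= c0 -> 0 < c1 -> (forall x, 0 <= V x) ->
  (forall L, exists s : seq (state I), forall x, V x <= L -> x \in s) ->
  (forall x, gen E lam mu z V x <= c0 - c1 * V x) ->
  exists pi : state I -> R,
    inv_prob E lam mu z pi /\
    (forall pi', inv_prob E lam mu z pi' -> pi' = pi) /\
    exists kappa : R, 0 < kappa /\ forall x : state I,
      ((expR (kappa * t))%:E * TVdist (fun y => Ptrans E lam mu z t x y) pi)%E
         @[t --> +oo] --> 0%E.
Proof.
move=> Nnt c00 c10 V0 sub drift.
pose A := \sum_(i < I) (lam i + \sum_(j < J | E i j) mu i j * (N j)%:R).
have A0 : 0 <= A.
  rewrite sumr_ge0 // => i _; rewrite addr_ge0 // sumr_ge0 // => j Eij.
  by rewrite mulr_ge0 // ltW // mu0.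
(* The term [2 * A] gives laziness; adding [c1] ensures [q > 0] and a nonnegative Lyapunov factor
   [1 - c1 / q]. *)
pose q := 2 * A + c1.
have q0 : 0 < q by rewrite /q; lra.
have qA : 2 * A <= q by rewrite /q; lra.
have PtE t x y : Ptrans E lam mu z t x y = semigroup (gen E lam mu z) t x y.
  rewrite /Ptrans /semigroup; congr (limn _); apply/funext => n; apply: eq_bigr => k _.
  by congr (_ * _); rewrite -QpowE.
have invE pi : inv_prob E lam mu z pi <-> stationary (gen E lam mu z) pi.
  split=> -[p0 [p1 pinv]]; do 2 split => //; move=> t t0 y.
    by rewrite -(pinv t t0 y); apply: eq_esum => x _; rewrite PtE.
  by rewrite -(pinv t t0 y); apply: eq_esum => x _; rewrite PtE.
have mP := unif_markov q0 qA.
have minor L : exists m0, forall m, (m0 <= m)%N -> exists2 d : R, 0 < d &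
    forall x (f : state I -> R), V x <= L -> (forall u, 0 <= f u) ->
      d * f [ffun=> 0%N] <= iter m (unif q) f x.
  have [s hs] := sub L.
  (* From the largest total population in the finite sublevel set on, the empty state is reached
     from all its points, and the least of these finitely many probabilities serves as [d]. *)
  exists (\max_(x <- s) \sum_(i < I) x i)%N => m hm.
  have [x xs|d d0 hd] := @list_min_gt0 _ s (iter m (unif q) (ind R [ffun=> 0%N])).
    apply: (hit_empty q0 qA Nnt); apply: leq_trans hm.
    by rewrite (big_rem x xs) /= leq_maxl.
  exists d => // x f Vx f0; have mPm := markov_iter mP m.
  apply: (@le_trans _ _ (iter m (unif q) (fun u => f [ffun=> 0%N] * ind R [ffun=> 0%N] u) x)).
    by rewrite (mopZ mPm) mulrC ler_wpM2l // hd // hs.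
  apply: (mop_le mPm) => u; rewrite /ind.
  by have [->|_] := eqVneq u; rewrite ?mulr1 ?mulr0.
have QE f x : gen E lam mu z f x = q * (unif q f x - f x).
  by rewrite /unif addrAC subrr add0r mulrC divfK // gt_eqF.
have g0 : 0 <= 1 - c1 / q by rewrite subr_ge0 ler_pdivrMr //; rewrite /q; lra.
have g1 : 1 - c1 / q < 1 by rewrite ltrBlDr ltrDl divr_gt0.
have K0 : 0 <= c0 / q by rewrite divr_ge0 // ltW.
have PV x : unif q V x <= (1 - c1 / q) * V x + c0 / q.
  have : gen E lam mu z V x / q <= (c0 - c1 * V x) / q by rewrite ler_pM2r ?invr_gt0.
  rewrite /unif; lra.
have [pi [pinv [puniq [kappa [kappa0 H]]]]] :=
  exponential_ergodicity mP QE q0 V0 g0 g1 K0 PV minor sub.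
exists pi; split; first exact/invE.
split; first by move=> pi' /invE; exact: puniq.
exists kappa; split => // x.
rewrite (_ : (fun t => _) = (fun t : R => ((expR (kappa * t))%:E *
   \esum_(y in [set: state I]) (`|semigroup (gen E lam mu z) t x y - pi y|)%:E)%E)); first exact: H.
apply/funext => t; congr (_ * _)%E; rewrite /TVdist; apply: eq_esum => y _.
by rewrite PtE.
Qed.

End Chain.

(** * Finite sublevel sets and drift under balanced policies *)

Lemma bounded_states_finite (I B : nat) :
  exists s : seq (state I), forall x : state I, (forall i, (x i <= B)%N) -> x \in s.
Proof.
exists [seq ([ffun i => nat_of_ord (f i)] : state I) | f : {ffun 'I_I -> 'I_B.+1}] => x xB.
apply/mapP; exists [ffun i => inord (x i)]; first by rewrite mem_enum.
by apply/ffunP => i; rewrite !ffunE inordK // ltnS.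
Qed.

Section LyapunovChain.
Variables (R : realType) (I J : nat) (E : 'I_I -> 'I_J -> bool).

Lemma sum_sq_shift (y y' : 'I_I -> R) i d : y' i = y i + d ->
  (forall k, k != i -> y' k = y k) ->
  \sum_(k < I) y' k ^+ 2 = \sum_(k < I) y k ^+ 2 + 2 * d * y i + d ^+ 2.
Proof.
move=> yi yk; rewrite (bigD1 i) //= yi [in RHS](bigD1 i) //=.
by rewrite (eq_bigr (fun k => y k ^+ 2)) => [|k ki]; [ring|rewrite yk].
Qed.

(** The exponent is [eps (r - 1 / r) >= eps (r - 1)], and [exp u >= 1 + u], so [V <= L] bounds [r]
    and hence each coordinate from above. Populations are natural numbers, so an upper bound leaves
    finitely many states. *)
Lemma Veps_sublevel (eps : R) n (Nt : 'I_I -> 'I_J -> int) L : 0 < eps -> (0 < n)%N ->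
  exists s : seq (state I), forall x, Veps eps (xtil E n Nt x) <= L -> x \in s.
Proof.
move=> e0 n0; have sn : 0 < Num.sqrt n%:R :> R by rewrite sqrtr_gt0 ltr0n.
pose c : R := `|L| / eps + 1.
pose U i : R := `|(Ntil_i E Nt i)%:~R + Num.sqrt n%:R * c|.
have U0 i : 0 <= U i by exact: normr_ge0.
have [s hs] := bounded_states_finite I (\max_(i < I) Num.bound (U i)).
exists s => x Vx; apply: hs => i.
apply: leq_trans (leq_bigmax i); rewrite ltnW // -(ltr_nat R).
apply: le_lt_trans (archi_boundP (U0 i)); apply: le_trans (ler_norm _).
rewrite -lerBlDl mulrC -ler_pdivrMr // -/(xtil E n Nt x i).
move: Vx; rewrite /Veps; set y := xtil E n Nt x; set S := \sum_(k < I) _ => Vx.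
have yS : y i ^+ 2 <= S.
  by rewrite /S (bigD1 i) //= lerDl sumr_ge0 // => k _; exact: sqr_ge0.
have S0 : 0 <= S by apply: le_trans yS; exact: sqr_ge0.
pose r := Num.sqrt (1 + S).
have r1 : 1 <= r by rewrite /r -{1}sqrtr1 ler_sqrt; lra.
have r0 : 0 < r by lra.
have rS : S = r ^+ 2 - 1 by rewrite sqr_sqrtr; lra.
have yr : y i <= r.
  by apply: le_trans (ler_norm _) _; rewrite -sqrtr_sqr ler_sqrt; lra.
have : 1 + eps * S / r <= `|L|.
  apply: le_trans (expR_ge1Dx _) _; exact: le_trans Vx (ler_norm _).
have -> : eps * S / r = eps * (r - r^-1) by rewrite rS; field; rewrite gt_eqF.
have ri : r^-1 <= 1 by rewrite invf_le1.
rewrite /c => h.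
suff : r - 1 <= `|L| / eps by lra.
rewrite ler_pdivlMr //.
have : eps * (r - 1) <= eps * (r - r^-1) by rewrite ler_pM2l //; lra.
lra.
Qed.

(** The scaled drift is the weighted sum of the [Nt - z], minus [a], plus an error of size at most
    [a / 2]. Above the target all terms [Nt - z] are nonpositive and [- a / 2] remains. Below it
    they are nonnegative and add up to the deficit, giving a pull of at least [m |y|]. *)
Lemma balanced_drift (lam : 'I_I -> R) (mu : 'I_I -> 'I_J -> R) (N : 'I_J -> nat)
    (Nt : 'I_I -> 'I_J -> int) (z : policy I J) n (x : state I) (i : 'I_I) (a m c B : R) :
  (0 < n)%N -> balanced E N Nt z -> 0 < m -> (forall j, E i j -> m <= mu i j) ->
  0 < c -> 2 * c <= a -> a <= B ->
  `|(lam i - (\sum_(j < J | E i j) mu i j * (Nt i j)%:~R - a * Num.sqrt n%:R))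
     / Num.sqrt n%:R| <= a / 2 ->
  (Num.sqrt n%:R)^-1 * (xtil E n Nt x i * (lam i - death_rate E mu z x i)) <=
    (3 / 2 * B + c) ^+ 2 / (4 * m) - c * `|xtil E n Nt x i|.
Proof.
move=> n0 [_ bal] m0 hm c0 ca aB herr.
have sn : 0 < Num.sqrt n%:R :> R by rewrite sqrtr_gt0 ltr0n.
have [bal1 bal2] := bal x i.
set y := xtil E n Nt x i; set h := (Num.sqrt n%:R)^-1.
set e := (X in `|X|) in herr.
have h0 : 0 < h by rewrite invr_gt0.
have lamE : h * (lam i - death_rate E mu z x i) =
   h * (\sum_(j < J | E i j) mu i j * ((Nt i j)%:~R - (z x i j)%:R)) - a + e.
  rewrite (eq_bigr (fun j => mu i j * (Nt i j)%:~R - mu i j * (z x i j)%:R)); last first.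
    by move=> j _; rewrite mulrBr.
  rewrite sumrB /e /h /death_rate; field; rewrite gt_eqF //.
have [e1 e2] : e <= a / 2 /\ - (a / 2) <= e by move: herr; rewrite ler_norml => /andP[].
rewrite mulrCA lamE.
have K0 : 0 <= (3 / 2 * B + c) ^+ 2 / (4 * m).
  by rewrite divr_ge0 ?sqr_ge0 // mulr_ge0 // ltW.
have [hx|hx] := leP ((x i)%:Z) (Ntil_i E Nt i).
  have [b1 b2] := bal1 hx.
  have y0 : y <= 0.
    rewrite /y /xtil pmulr_lle0 ?invr_gt0 // subr_le0.
    by rewrite -[(x i)%:R]/((x i)%:Z%:~R) ler_int.
  have S1 : m * - y <= h * (\sum_(j < J | E i j) mu i j * ((Nt i j)%:~R - (z x i j)%:R)).
    have -> : m * - y = h * (m * ((Ntil_i E Nt i)%:~R - (x i)%:R)).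
      by rewrite /y /xtil -/h; ring.
    rewrite ler_pM2l // /Ntil_i -b2 natr_sum rmorph_sum /= -sumrB mulr_sumr.
    apply: ler_sum => j Eij; apply: ler_wpM2r; last exact: hm.
    by rewrite subr_ge0 -[(z x i j)%:R]/((z x i j)%:Z%:~R) ler_int; exact: b1.
  rewrite (ler0_norm y0).
  have : y * (h * (\sum_(j < J | E i j) mu i j * ((Nt i j)%:~R - (z x i j)%:R)) - a + e) <=
     y * (m * - y - 3 / 2 * B).
    apply: ler_wnM2l => //; lra.
  move=> /le_trans; apply; rewrite -subr_ge0.
  (* Completing the square: the constant is the maximum of [(3 / 2 * B + c) |y| - m y^2]. *)
  have -> : (3 / 2 * B + c) ^+ 2 / (4 * m) - c * - y - y * (m * - y - 3 / 2 * B) =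
     m * (y + (3 / 2 * B + c) / (2 * m)) ^+ 2.
    by field; rewrite gt_eqF.
  by rewrite mulr_ge0 ?sqr_ge0 // ltW.
have y0 : 0 < y.
  rewrite /y /xtil divr_gt0 // subr_gt0.
  by rewrite -[(x i)%:R]/((x i)%:Z%:~R) ltr_int.
have S1 : h * (\sum_(j < J | E i j) mu i j * ((Nt i j)%:~R - (z x i j)%:R)) <= 0.
  rewrite pmulr_rle0 //; apply: sumr_le0 => j Eij.
  rewrite pmulr_rle0 ?(lt_le_trans m0 (hm j Eij)) // subr_le0.
  by rewrite -[(z x i j)%:R]/((z x i j)%:Z%:~R) ler_int; exact: bal2.
rewrite (gtr0_norm y0).
have : y * (h * (\sum_(j < J | E i j) mu i j * ((Nt i j)%:~R - (z x i j)%:R)) - a + e) <=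
     y * (- c) by rewrite ler_pM2l //; lra.
lra.
Qed.

Lemma gen_Veps_le (lam : 'I_I -> R) (mu : 'I_I -> 'I_J -> R) (N : 'I_J -> nat)
    (Nt : 'I_I -> 'I_J -> int) (z : policy I J) n (eps c K1 K2 C3 : R) :
  (forall i, 0 <= lam i) -> (forall i j, E i j -> 0 < mu i j) -> (0 < n)%N ->
  (forall x, in_Zn E N x (z x)) ->
  0 < c -> 0 <= K1 -> 0 <= K2 -> 0 < eps -> eps <= 1 / 6 ->
  18 * I%:R * K2 * eps <= c / 4 ->
  (forall x i, (lam i + death_rate E mu z x i) / n%:R <= K2) ->
  (forall x i, (Num.sqrt n%:R)^-1 * (xtil E n Nt x i * (lam i - death_rate E mu z x i)) <=
    K1 - c * `|xtil E n Nt x i|) ->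
  C3 = c + I%:R * (K1 + K2) ->
  forall x, gen E lam mu z (fun w => Veps eps (xtil E n Nt w)) x <=
    eps * (2 * C3 + c) * expR (8 * C3 / c) - eps * c / 2 * Veps eps (xtil E n Nt x).
Proof.
move=> lam0 mu0 n0 zN c0 K10 K20 e0 e1 eK hK2 hK1 C3E x; rewrite genE.
have sn : 1 <= Num.sqrt n%:R :> R by rewrite -{1}sqrtr1 ler_sqrt ?ler1n ?ler0n.
have sn0 : 0 < Num.sqrt n%:R :> R by lra.
pose h : R := (Num.sqrt n%:R)^-1.
have h2 : h ^+ 2 = n%:R^-1 by rewrite /h exprVn sqr_sqrtr ?ler0n.
apply: (@drift_combine R I eps c K1 K2 h (\sum_(i < I) xtil E n Nt x i ^+ 2) _ C3
  (xtil E n Nt x) lam (death_rate E mu z x)) => //.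
- by rewrite invr_gt0.
- by rewrite invf_le1.
- by move=> i; exact: death_rate_ge0.
- by move=> i; rewrite h2 mulrC; exact: hK2.
- move=> i; rewrite le_eqVlt; apply/orP; left; apply/eqP.
  rewrite /Veps (@sum_sq_shift (xtil E n Nt x) _ i h) // => [|k ki]; rewrite /xtil ffunE.
    by rewrite eqxx -natr1 /h; ring.
  by rewrite (negbTE ki).
- move=> i; have [xi|xi] := posnP (x i).
    by rewrite (death_rate_eq0 mu zN xi) !mul0r.
  rewrite le_eqVlt; apply/orP; left; apply/eqP; congr (_ * _).
  have xE : (x i)%:R = (x i).-1%:R + 1 :> R by rewrite natr1 prednK.
  rewrite /Veps (@sum_sq_shift (xtil E n Nt x) (xtil E n Nt (e_down x i)) i (- h)).
  - by congr expR; rewrite sqrrN mulrN mulNr.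
  - by rewrite /xtil ffunE eqxx xE /h; ring.
  - by move=> k ki; rewrite /xtil ffunE (negbTE ki).
Qed.

End LyapunovChain.

(** * Uniform constants and conclusion *)

Lemma fin_lower_bound (R : realType) (T : finType) (f : T -> R) : (forall t, 0 < f t) ->
  exists2 c, 0 < c & forall t, c <= f t.
Proof.
move=> f0; have [t _|c c0 hc] := @list_min_gt0 R T (enum T) f; first exact: f0.
by exists c => // t; apply: hc; rewrite mem_enum.
Qed.

Theorem theorem8 (R : realType) (I J : nat) (E : 'I_I -> 'I_J -> bool)
  (lam : nat -> 'I_I -> R) (mu : nat -> 'I_I -> 'I_J -> R) (Nn : nat -> 'I_J -> nat)
  (lamL lamh : 'I_I -> R) (muL muh : 'I_I -> 'I_J -> R) (nu nuh : 'I_J -> R)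
  (xistar : 'I_I -> 'I_J -> R) (Nij : nat -> 'I_I -> 'I_J -> nat)
  (p : 'I_I -> R) (vth : R) (Nt : nat -> 'I_I -> 'I_J -> int) :
  (* network *)
  is_tree E ->
  (* parameters *)
  (forall n i, 0 < lam n i) ->
  (forall n i j, E i j -> 0 < mu n i j) ->
  (forall i, 0 < lamL i) -> (forall j, 0 < nu j) -> (forall i j, E i j -> 0 < muL i j) ->
  (forall i, (fun n : nat => lam n i / n%:R) @ \oo --> lamL i) ->
  (forall j, (fun n : nat => (Nn n j)%:R / n%:R) @ \oo --> nu j) ->
  (forall i j, E i j -> (fun n : nat => mu n i j) @ \oo --> muL i j) ->
  (forall i, (fun n : nat => (lam n i - n%:R * lamL i) / Num.sqrt n%:R) @ \oo --> lamh i) ->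
  (forall i j, E i j ->
     (fun n : nat => Num.sqrt n%:R * (mu n i j - muL i j)) @ \oo --> muh i j) ->
  (forall j, (fun n : nat => Num.sqrt n%:R * ((Nn n j)%:R / n%:R - nu j)) @ \oo --> nuh j) ->
  (* complete resource pooling *)
  crp_optimal E lamL muL nu xistar ->
  (forall xi, crp_optimal E lamL muL nu xi -> forall i j, xi i j = xistar i j) ->
  (forall j, \sum_(i < I) xistar i j = 1) ->
  (forall i j, E i j -> 0 < xistar i j) ->
  (* the integers N^n_ij *)
  (forall n i j, (Num.floor (xistar i j * (Nn n j)%:R) <= (Nij n i j)%:Z)%R /\
                 ((Nij n i j)%:Z <= Num.ceil (xistar i j * (Nn n j)%:R))%R) ->
  (forall n j, (\sum_(i < I) Nij n i j)%N = Nn n j) ->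
  (* p positive probability vector, vartheta_p > 0 *)
  (forall i, 0 < p i) -> \sum_(i < I) p i = 1 ->
  swss_value E lamh muL muh nu nuh xistar p vth -> 0 < vth ->
  (* the integers tilde N^n_ij of Lemma 5 *)
  (forall i, (fun n : nat =>
      (lam n i - (\sum_(j < J | E i j) mu n i j * (Nt n i j)%:~R
                  - vth * p i * Num.sqrt n%:R)) / Num.sqrt n%:R) @ \oo --> 0) ->
  (exists C : R, exists n1 : nat, forall n, (n1 <= n)%N -> forall i j, E i j ->
      `|(Nij n i j)%:R - (Nt n i j)%:~R| <= C * Num.sqrt n%:R) ->
  (exists n1 : nat, forall n, (n1 <= n)%N -> forall j,
      \sum_(i < I | E i j) Nt n i j = (Nn n j)%:Z) ->
  exists eps : R, 0 < eps /\ exists n0 : nat, exists C0 C1 : R, 0 < C0 /\ 0 < C1 /\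
    (forall n, (n0 <= n)%N -> forall z, balanced E (Nn n) (Nt n) z ->
       forall x : state I,
         gen E (lam n) (mu n) z (fun w => Veps eps (xtil E n (Nt n) w)) x
           <= C0 - C1 * Veps eps (xtil E n (Nt n) x)) /\
    (forall n, (n0 <= n)%N -> forall z, balanced E (Nn n) (Nt n) z ->
       exists pi : state I -> R,
         inv_prob E (lam n) (mu n) z pi /\
         (forall pi', inv_prob E (lam n) (mu n) z pi' -> pi' = pi) /\
         exists kappa : R, 0 < kappa /\
           forall x : state I,
             ((expR (kappa * t))%:E *
                TVdist (fun y => Ptrans E (lam n) (mu n) z t x y) pi)%E
               @[t --> +oo] --> 0%E).
Proof.
move=> _ lam0 mu0 lamL0 nu0 muL0 hlam hN hmu _ _ _ [[xi0 [_ xisum]] _] _ _ _ _ _.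
move=> p0 psum _ vth0 herr _ _.
(* A class without a compatible pool would turn its flow balance in the linear program into
   [0 = lamL i]. *)
have neighbour i : exists j, E i j.
  apply: contrapT => H; have := lamL0 i; rewrite -xisum big1 ?ltxx // => j _.
  by rewrite xi0 ?mulr0 //; apply/negP => Eij; apply: H; exists j.
have a0 i : 0 < vth * p i / 2 by rewrite divr_gt0 // mulr_gt0.
(* [c] is a common inward speed: half the safety margin [vth * p i], the other half absorbing the
   error of the targets. *)
have [c c0 hc] := fin_lower_bound a0.
have pv i : vth * p i <= vth.
  rewrite ler_piMr ?(ltW vth0) // -psum (bigD1 i) //= lerDl sumr_ge0 // => k _.
  exact: ltW.
have [m m0 hm] : exists2 m : R, 0 < m & forall i j, E i j -> m <= muL i j / 2.
  have f0 (ij : 'I_I * 'I_J) : 0 < (if E ij.1 ij.2 then muL ij.1 ij.2 / 2 else 1).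
    by case: ifP => // Eij; rewrite divr_gt0 // muL0.
  have [m m0 hm] := fin_lower_bound f0.
  by exists m => // i j Eij; have := hm (i, j); rewrite /= Eij.
(* Limits enlarged by 1 dominate the scaled rates of all large systems; summing over the classes
   gives a single bound. *)
pose K2 : R := \sum_(i < I) (lamL i + 1 + \sum_(j < J | E i j) (muL i j + 1) * (nu j + 1)).
have T0 i : 0 <= \sum_(j < J | E i j) (muL i j + 1) * (nu j + 1).
  rewrite sumr_ge0 // => j Eij; have := muL0 i j Eij; have := nu0 j => u v.
  by rewrite mulr_ge0 //; lra.
have T1 i : 0 <= lamL i + 1 + \sum_(j < J | E i j) (muL i j + 1) * (nu j + 1).
  by have := T0 i; have := lamL0 i; lra.
have K20 : 0 <= K2 by rewrite sumr_ge0.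
pose K1 : R := (3 / 2 * vth + c) ^+ 2 / (4 * m).
have K10 : 0 <= K1 by rewrite divr_ge0 ?sqr_ge0 // mulr_ge0 // ltW.
pose C3 := c + I%:R * (K1 + K2).
have C30 : 0 < C3 by rewrite ltr_pwDl // mulr_ge0 // addr_ge0.
pose D : R := 18 * I%:R * K2.
have D0 : 0 <= D by rewrite !mulr_ge0.
(* The bound 1/6 is for the exponential expansion, the other makes the second order error at most
   [c / 4]; [D + 1] avoids dividing by 0. *)
pose eps := Num.min (1 / 6) (c / 4 / (D + 1)).
have e0 : 0 < eps by rewrite lt_min !divr_gt0 //; lra.
have e1 : eps <= 1 / 6 by rewrite ge_min lexx.
have eK : D * eps <= c / 4.
  apply: (@le_trans _ _ ((D + 1) * eps)); first by rewrite ler_pM2r //; lra.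
  by rewrite mulrC -ler_pdivlMr ?ge_min ?lexx ?orbT //; lra.
have ev_mu : \forall n \near \oo, forall i j, E i j -> m <= mu n i j /\ mu n i j <= muL i j + 1.
  apply: filter_forall => i; apply: filter_forall => j.
  have [Eij|] := boolP (E i j); last by move=> ?; apply: nearW.
  have mu2 : 0 < Num.min (muL i j / 2) 1 by rewrite lt_min divr_gt0 ?muL0 //=.
  have /cvgrPdist_lt /(_ _ mu2) := hmu i j Eij.
  apply: filterS => n; rewrite lt_min !ltr_norml => /andP[/andP[_ h1] /andP[h2 _]] _.
  by have := hm i j Eij; split; lra.
have ev_N : \forall n \near \oo, forall j, (Nn n j)%:R / n%:R <= nu j + 1 /\ (0 < Nn n j)%N.
  apply: filter_forall => j.
  have nu2 : 0 < Num.min (nu j) 1 by rewrite lt_min nu0 /=.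
  have /cvgrPdist_lt /(_ _ nu2) := hN j.
  apply: filterS => n; rewrite lt_min !ltr_norml => /andP[/andP[_ h1] /andP[h2 _]].
  split; first by lra.
  (* An empty pool would be at distance [nu j] from the limit, contradicting the strict bound. *)
  rewrite lt0n; apply/eqP => N0; move: h1; rewrite N0 mul0r; lra.
have ev_lam : \forall n \near \oo, forall i, lam n i / n%:R <= lamL i + 1.
  apply: filter_forall => i; have /cvgrPdist_lt /(_ _ ltr01) := hlam i.
  by apply: filterS => n; rewrite ltr_norml => /andP[h _]; lra.
have ev_err : \forall n \near \oo, forall i,
    `|(lam n i - (\sum_(j < J | E i j) mu n i j * (Nt n i j)%:~R
        - vth * p i * Num.sqrt n%:R)) / Num.sqrt n%:R| <= vth * p i / 2.
  apply: filter_forall => i; have /cvgrPdist_lt /(_ _ (a0 i)) := herr i.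
  by apply: filterS => n; rewrite sub0r normrN => /ltW.
have ev_pos : \forall n \near \oo, (0 < n)%N by exists 1%N.
(* All asymptotics enter through this one threshold, chosen before the policy and the state. *)
have [n0 _ H0] : \forall n \near \oo, [/\ (0 < n)%N,
    forall i j, E i j -> m <= mu n i j /\ mu n i j <= muL i j + 1,
    forall j, (Nn n j)%:R / n%:R <= nu j + 1 /\ (0 < Nn n j)%N,
    forall i, lam n i / n%:R <= lamL i + 1 &
    forall i, `|(lam n i - (\sum_(j < J | E i j) mu n i j * (Nt n i j)%:~R
        - vth * p i * Num.sqrt n%:R)) / Num.sqrt n%:R| <= vth * p i / 2].
  by near=> n; split; near: n.
have drift n : (n0 <= n)%N -> forall z, balanced E (Nn n) (Nt n) z -> forall x : state I,
    gen E (lam n) (mu n) z (fun w => Veps eps (xtil E n (Nt n) w)) x <=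
    eps * (2 * C3 + c) * expR (8 * C3 / c) - eps * c / 2 * Veps eps (xtil E n (Nt n) x).
  move=> n0n z bal; have [npos Hmu HN Hlam Herr] := H0 n n0n.
  have nR : 0 < n%:R :> R by rewrite ltr0n.
  apply: (@gen_Veps_le R I J E (lam n) (mu n) (Nn n) (Nt n) z n eps c K1 K2 C3) => //.
  - by move=> i; exact: ltW.
  - by move=> i j; exact: mu0.
  - exact: bal.1.
  - move=> x i; apply: (@le_trans _ _
      (lamL i + 1 + \sum_(j < J | E i j) (muL i j + 1) * (nu j + 1))); last first.
      by rewrite /K2 (bigD1 i) //= lerDl sumr_ge0.
    rewrite mulrDl; apply: lerD; first exact: Hlam.
    apply: (@le_trans _ _ ((\sum_(j < J | E i j) mu n i j * (Nn n j)%:R) / n%:R)).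
      by rewrite ler_pM2r ?invr_gt0 //; apply: death_rate_le (mu0 n) bal.1 x i.
    rewrite mulr_suml; apply: ler_sum => j Eij; rewrite -mulrA.
    apply: ler_pM; [exact/ltW/mu0|by rewrite divr_ge0|exact: (Hmu i j Eij).2|exact: (HN j).1].
  move=> x i.
  apply: (@balanced_drift R I J E (lam n) (mu n) (Nn n) (Nt n) z n x i (vth * p i) m c vth) => //.
  - by move=> j Eij; exact: (Hmu i j Eij).1.
  - by have := hc i; lra.
exists eps; split => //; exists n0, (eps * (2 * C3 + c) * expR (8 * C3 / c)), (eps * c / 2).
have C00 : 0 < eps * (2 * C3 + c) * expR (8 * C3 / c).
  by rewrite !mulr_gt0 ?expR_gt0 //; lra.
have C10 : 0 < eps * c / 2 by rewrite divr_gt0 // mulr_gt0.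
do 2 split => //; split => // n n0n z bal; have [npos _ HN _ _] := H0 n n0n.
apply: (@chain_ergodic R I J E (Nn n) (lam n) (mu n) z _ _ bal.1
  (fun w => Veps eps (xtil E n (Nt n) w)) (eps * (2 * C3 + c) * expR (8 * C3 / c)) (eps * c / 2)) => //.
- by move=> i; exact: ltW.
- by move=> i j; exact: mu0.
- by move=> i; have [j Eij] := neighbour i; exists j => //; exact: (HN j).2.
- exact: ltW.
- by move=> x; exact: expR_ge0.
- by move=> L; exact: Veps_sublevel.
- exact: drift.
Unshelve. all: by end_near. Qed.
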